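(* Let $\Omega\subset\mathbb{R}^N$ be a bounded domain, let $1\le j\le N$, and let $g:\partial\Omega\to\mathbb{R}$ be continuous. Let $H_j$ be the set of functions $v$ such that $v\le g$ on $\partial\Omega$ and which have the following property: for every affine subspace $S\subset\mathbb{R}^N$ of dimension $j$ and every $j$-dimensional domain $D\subset S\cap\Omega$, it holds that $v\le z$ in $D$, where $z$ is the concave envelope of $v|_{\partial D}$ in $D$. Then the function $$u(x)=\sup_{v\in H_j}v(x)$$ is the largest viscosity solution to $\lambda_j(D^2u)=0$ in $\Omega$, with $u\le g$ on $\partial\Omega$.
   Context: For a symmetric $N\times N$ matrix $X$, $\lambda_1(X)\le\dots\le\lambda_N(X)$ denote its ordered eigenvalues; $D^2u$ is the Hessian of $u$. The functions $v$ in $H_j$ are real-valued functions on $\overline\Omega$, not assumed continuous. The boundary $\partial D$ of a $j$-dimensional domain $D\subset S\cap\Omega$ is taken relative to $S$. The concave envelope in $D$ of a function given on $\partial D$ is the infimum of the concave functions that are above that function on $\partial D$. Semicontinuous envelopes: $u_*(x)=\sup_{r>0}\inf_{y\in B_r(x)}u(y)$ and $u^*(x)=\inf_{r>0}\sup_{y\in B_r(x)}u(y)$, where $B_r(x)$ is the ball of radius $r$ centered at $x$ (points $y$ being taken in the domain of $u$). Viscosity sense: a (not necessarily continuous) function $u$ is a viscosity solution to $\lambda_j(D^2u)=0$ in $\Omega$ if (1) for every $\phi\in C^2$ such that $u_*-\phi$ has a strict minimum at a point $x\in\Omega$ with $u_*(x)=\phi(x)$, one has $\lambda_j(D^2\phi(x))\le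 0$; and (2) for every $\psi\in C^2$ such that $u^*-\psi$ has a strict maximum at a point $x\in\Omega$ with $u^*(x)=\psi(x)$, one has $\lambda_j(D^2\psi(x))\ge 0$.
   Formalization: ''Largest'' is proved among viscosity solutions w whose envelopes w_*, w^* are finite in Ω and with w^* ≤ g on ∂Ω; with only w ≤ g on ∂Ω it is false (w = max g + 1 in Ω, w = g on ∂Ω). For u itself, u ≤ g on ∂Ω is proved pointwise. *)

(* Defs.v *)
From HB Require Import structures.
From mathcomp Require Import all_boot all_order all_algebra.
From mathcomp Require Import all_classical all_reals all_analysis.

Set Implicit Arguments.
Unset Strict Implicit.
Unset Printing Implicit Defensive.

Import Order.TTheory GRing.Theory Num.Theory.
Import numFieldNormedType.Exports.

Local Open Scope classical_set_scope.
Local Open Scope ring_scope.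

(* For a symmetric real matrix X the characteristic polynomial splits over R, so
   exactly one sequence belongs to the set below: the nondecreasing list of the
   eigenvalues of X, repeated according to multiplicity.  The default [::] is
   used only for matrices whose characteristic polynomial does not split. *)
Definition ordered_eigenvalues (R : realType) (N : nat) (X : 'M[R]_N) : seq R :=
  xget [::] [set s : seq R |
    sorted <=%R s /\ char_poly X = \prod_(a <- s) ('X - a%:P)].

(* The index j of lambda is 1-based, the index of nth is 0-based. *)
Definition lambda (R : realType) (N j : nat) (X : 'M[R]_N) : R :=
  nth 0 (ordered_eigenvalues X) j.-1.

Definition pderiv (R : realType) (N : nat) (i : 'I_N) (f : 'rV[R]_N -> R) :
    'rV[R]_N -> R :=
  fun x => 'D_(delta_mx 0 i) f x.

Definition hessian (R : realType) (N : nat) (f : 'rV[R]_N -> R) (x : 'rV[R]_N) :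
    'M[R]_N :=
  \matrix_(i, k) pderiv k (pderiv i f) x.

Definition C2_on (R : realType) (N : nat) (U : set 'rV[R]_N)
    (f : 'rV[R]_N -> R) : Prop :=
  forall (x : 'rV[R]_N) (i k : 'I_N), U x ->
    [/\ derivable f x (delta_mx 0 i),
        {for x, continuous (pderiv i f)},
        derivable (pderiv i f) x (delta_mx 0 k)
      & {for x, continuous (pderiv k (pderiv i f))}].

(* The topological boundary of A relative to S; for S = setT this is the usual
   boundary of A. *)
Definition boundary_in (T : topologicalType) (S A : set T) : set T :=
  S `&` closure A `&` closure (S `\` A).

Definition domain (T : topologicalType) (A : set T) : Prop :=
  [/\ open A, connected A & A !=set0].

Definition affine_subspace (R : realType) (N j : nat) (S : set 'rV[R]_N) : Prop :=
  exists (p : 'rV[R]_N) (V : {vspace 'rV[R]_N}),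
    \dim V = j /\ S = [set x | x - p \in V].

Definition domain_in (T : topologicalType) (S D : set T) : Prop :=
  [/\ exists2 U : set T, open U & D = S `&` U, connected D & D !=set0].

Definition convex_hull (R : realType) (N : nat) (A : set 'rV[R]_N) :
    set 'rV[R]_N :=
  [set x | forall C : set 'rV[R]_N,
     @convex_set R 'rV[R]_N C -> A `<=` C -> C x].

Definition concave_on (R : realType) (N : nat) (K : set 'rV[R]_N)
    (f : 'rV[R]_N -> R) : Prop :=
  @convex_function R 'rV[R]_N K (fun x => - f x).

(* D need not be convex, so the competitors are the concave functions on the
   convex hull of its closure (the closure itself when D is convex).  For D open
   in S, the concave functions on S, or the affine ones, give the same infimum at
   the points of D, since a concave function on that hull has a supporting affine
   function at each point of D.  The infimum over the empty set is +oo. *)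
Definition concave_envelope (R : realType) (N : nat) (S D : set 'rV[R]_N)
    (v : 'rV[R]_N -> R) (x : 'rV[R]_N) : \bar R :=
  ereal_inf [set (f x)%:E | f in [set f : 'rV[R]_N -> R |
    concave_on (convex_hull (closure D)) f /\
    forall y, boundary_in S D y -> v y <= f y]].

(* A function on the closure of Omega is represented by a total function whose
   values outside that closure are irrelevant. *)
Definition H_class (R : realType) (N j : nat) (Omega : set 'rV[R]_N)
    (g : 'rV[R]_N -> R) : set ('rV[R]_N -> R) :=
  [set v | (forall x, boundary_in setT Omega x -> v x <= g x) /\
    forall S D : set 'rV[R]_N,
      affine_subspace j S -> domain_in S D -> D `<=` Omega ->
      forall x, D x -> ((v x)%:E <= concave_envelope S D v x)%E].

(* In the two envelopes A is the domain of u.  The balls are those of the sup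
   norm of 'rV[R]_N; every Euclidean ball contains one and conversely, so
   Euclidean balls give the same envelopes. *)
Definition lsc_env (R : realType) (N : nat) (A : set 'rV[R]_N)
    (u : 'rV[R]_N -> R) (x : 'rV[R]_N) : \bar R :=
  ereal_sup [set ereal_inf [set (u y)%:E | y in ball x r `&` A]
            | r in [set r : R | 0 < r]].

Definition usc_env (R : realType) (N : nat) (A : set 'rV[R]_N)
    (u : 'rV[R]_N -> R) (x : 'rV[R]_N) : \bar R :=
  ereal_inf [set ereal_sup [set (u y)%:E | y in ball x r `&` A]
            | r in [set r : R | 0 < r]].

Definition strict_min (R : realType) (T : Type) (A : set T) (F : T -> \bar R)
    (x : T) : Prop :=
  forall y, A y -> y <> x -> (F x < F y)%E.

Definition strict_max (R : realType) (T : Type) (A : set T) (F : T -> \bar R)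
    (x : T) : Prop :=
  forall y, A y -> y <> x -> (F y < F x)%E.

(* The fin_num clause says that u_* and u^* are real-valued in Omega, that is,
   that u is locally bounded there.  Without it, a function with u^* = +oo and
   u_* = 0 in an open set would pass every test there. *)
Definition viscosity_solution (R : realType) (N j : nat) (Omega : set 'rV[R]_N)
    (u : 'rV[R]_N -> R) : Prop :=
  let lo := lsc_env (closure Omega) u in
  let up := usc_env (closure Omega) u in
  [/\ forall x, Omega x -> lo x \is a fin_num /\ up x \is a fin_num,
      forall (phi : 'rV[R]_N -> R) (x : 'rV[R]_N),
        C2_on Omega phi -> Omega x ->
        strict_min Omega (fun y => lo y - (phi y)%:E)%E x ->
        lo x = (phi x)%:E ->
        lambda j (hessian phi x) <= 0
    & forall (psi : 'rV[R]_N -> R) (x : 'rV[R]_N),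
        C2_on Omega psi -> Omega x ->
        strict_max Omega (fun y => up y - (psi y)%:E)%E x ->
        up x = (psi x)%:E ->
        0 <= lambda j (hessian psi x)].

Definition sup_H (R : realType) (N j : nat) (Omega : set 'rV[R]_N)
    (g : 'rV[R]_N -> R) (x : 'rV[R]_N) : R :=
  sup [set v x | v in H_class j Omega g].

(* Main.v *)
(* Two halves of the Courant-Fischer principle translate the sign of lambda_j
   into planes: if lambda_j(X) < 0 then X is negative on some j-dimensional space,
   and if lambda_j(X) >= 0 then every j-dimensional space contains a direction on
   which X is nonnegative.  The class H_j is stable under suprema, so u is in H_j.
   A test function with lambda_j < 0 touching u from above would be concave on a
   small j-dimensional disc, contradicting the comparison on that disc; if one with
   lambda_j > 0 touched u from below, a bump could be added to u inside H_j.
   Conversely, the upper envelope of a solution is in H_j: in a j-dimensional D a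
   concave majorant f of its boundary values is replaced by an affine support
   at the point under consideration, and a paraboloid that is slightly concave along
   D and very convex across D would touch the envelope from above. *)

Require Import Defs.
From HB Require Import structures.
From mathcomp Require Import all_boot all_order all_algebra.
From mathcomp Require Import all_classical all_reals all_analysis.
From mathcomp Require Import ring lra zify.

Set Implicit Arguments.
Unset Strict Implicit.
Unset Printing Implicit Defensive.

Import Order.TTheory GRing.Theory Num.Theory.
Import numFieldNormedType.Exports.

Local Open Scope classical_set_scope.
Local Open Scope ring_scope.

(** * Quadratic forms and eigenvalues *)

(** Neither u nor a solution w need be continuous, and a test function touches only an envelope,
    whose value at x need not be taken by u there. Both halves for u therefore argue at a nearby
    point [y0] where u is within [d / 2] of the envelope, and every comparison needs a margin [d].
    The margin comes from shifting the Hessian of the test function by a multiple of the identity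
    proportional to lambda_j; part of the shift pays for the Taylor remainder. Maximality meets
    another obstacle: the boundary inequality lives on D inside its plane, while the viscosity
    inequality needs a maximum in an open subset of R^N. Upper semicontinuity and compactness
    provide one penalization across the plane that works uniformly. As the tests demand a strict
    extremum over all of Omega, a local maximum is corrected by a term of order four, which leaves
    the Hessian unchanged. Eigenvalues are roots of the characteristic polynomial, so the min-max
    inequalities pass through an orthogonal diagonalization. *)

Section DotProduct.
Variables (R : realType) (n : nat).
Implicit Types (u v w : 'rV[R]_n) (X : 'M[R]_n).

Definition dot u v : R := (u *m v^T) 0 0.
Definition qform X u : R := dot (u *m X) u.

Lemma dotE u v : dot u v = \sum_i u 0 i * v 0 i.
Proof. by rewrite /dot mxE; apply: eq_bigr => i _; rewrite mxE. Qed.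

Lemma dotC u v : dot u v = dot v u.
Proof. by rewrite !dotE; apply: eq_bigr => i _; rewrite mulrC. Qed.

Lemma dotDl u v w : dot (u + v) w = dot u w + dot v w.
Proof. by rewrite /dot mulmxDl mxE. Qed.

Lemma dotZl a u w : dot (a *: u) w = a * dot u w.
Proof. by rewrite /dot -scalemxAl mxE. Qed.

Lemma dotDr w u v : dot w (u + v) = dot w u + dot w v.
Proof. by rewrite !(dotC w) dotDl. Qed.

Lemma dotZr a w u : dot w (a *: u) = a * dot w u.
Proof. by rewrite !(dotC w) dotZl. Qed.

Lemma dot0l w : dot 0 w = 0.
Proof. by rewrite /dot mul0mx mxE. Qed.

Lemma dotNl u w : dot (- u) w = - dot u w.
Proof. by rewrite -scaleN1r dotZl mulN1r. Qed.

Lemma dotNr w u : dot w (- u) = - dot w u.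
Proof. by rewrite !(dotC w) dotNl. Qed.

Lemma dot_mxr u X v : dot u (v *m X) = dot (u *m X^T) v.
Proof. by rewrite /dot trmx_mul mulmxA. Qed.

Lemma dot_delta u i : dot u (delta_mx 0 i) = u 0 i.
Proof.
rewrite dotE (bigD1 i)//= big1 ?addr0 ?mxE ?eqxx ?mulr1// => k ki.
by rewrite mxE (negPf ki) andbF mulr0.
Qed.

Lemma dot_ge0 u : 0 <= dot u u.
Proof. by rewrite dotE sumr_ge0// => i _; rewrite -expr2 sqr_ge0. Qed.

Lemma dot_eq0 u : (dot u u == 0) = (u == 0).
Proof.
apply/eqP/eqP => [|->]; last by rewrite dot0l.
rewrite dotE => /eqP; rewrite psumr_eq0 => [/allP u0|i _]; last by rewrite -expr2 sqr_ge0.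
apply/rowP => i; rewrite mxE; apply/eqP.
by have := u0 i; rewrite mem_index_enum mulf_eq0 orbb; apply.
Qed.

Lemma coord_norm_le u i : `|u 0 i| <= `|u|.
Proof.
rewrite [leRHS]/Num.Def.normr /= mx_normrE; apply/bigmax_geP; right => /=.
by exists (0, i).
Qed.

Lemma norm_leP u c : 0 <= c -> (forall i, `|u 0 i| <= c) -> `|u| <= c.
Proof.
move=> c0 uc; rewrite [leLHS]/Num.Def.normr /= mx_normrE; apply/bigmax_leP; split=> //.
by move=> [i k] _ /=; rewrite ord1.
Qed.

Lemma norm_sqr_le_dot u : `|u| ^+ 2 <= dot u u.
Proof.
rewrite -(sqr_sqrtr (dot_ge0 u)) ler_sqr ?nnegrE ?sqrtr_ge0//.
apply: norm_leP => [|i]; first exact: sqrtr_ge0.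
rewrite -sqrtr_sqr ler_wsqrtr// dotE (bigD1 i)//= -expr2 lerDl sumr_ge0// => k _.
by rewrite -expr2 sqr_ge0.
Qed.

Lemma qformE X u : qform X u = \sum_i \sum_k X i k * u 0 i * u 0 k.
Proof.
rewrite /qform dotE exchange_big; apply: eq_bigr => k _ /=.
by rewrite mxE mulr_suml; apply: eq_bigr => i _; rewrite mulrC; ring.
Qed.

Lemma qformZ X a u : qform X (a *: u) = a ^+ 2 * qform X u.
Proof. by rewrite /qform -scalemxAl dotZl dotZr; ring. Qed.

Lemma qform0 X : qform X 0 = 0.
Proof. by rewrite /qform mul0mx dot0l. Qed.

Lemma qform_dotD X u v :
  qform X (u + v) = qform X u + dot (u *m X) v + dot (v *m X) u + qform X v.
Proof. by rewrite /qform mulmxDl dotDl !dotDr; ring. Qed.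

Lemma qform_mxD X Y u : qform (X + Y) u = qform X u + qform Y u.
Proof. by rewrite /qform mulmxDr dotDl. Qed.

Lemma qform_mxZ a X u : qform (a *: X) u = a * qform X u.
Proof. by rewrite /qform -scalemxAr dotZl. Qed.

Lemma qform_scalar a u : qform a%:M u = a * dot u u.
Proof. by rewrite /qform mul_mx_scalar dotZl. Qed.

Lemma qform_conv X (t : R) u v :
  qform X (t *: u + (1 - t) *: v) =
  t * qform X u + (1 - t) * qform X v - t * (1 - t) * qform X (u - v).
Proof.
rewrite /qform !mulmxDl mulNmx -!scalemxAl.
by rewrite !(dotDl, dotDr, dotZl, dotZr, dotNl, dotNr); ring.
Qed.

Lemma continuous_bigsum m (F : 'I_m -> 'rV[R]_n -> R) :
  (forall i, continuous (F i)) -> continuous (fun u => \sum_i F i u).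
Proof. by move=> Fc; apply: continuous_big => //; apply: add_continuous. Qed.

Lemma dot_continuous u : continuous (dot u).
Proof.
rewrite (_ : dot u = fun w => \sum_i u 0 i * w 0 i); last first.
  by apply/funext => w; rewrite dotE.
apply: continuous_bigsum => i v.
apply: (@continuousM _ _ (cst (u 0 i)) (fun w : 'rV_n => w 0 i)).
  exact: cst_continuous.
exact: coord_continuous.
Qed.

Lemma qform_continuous X : continuous (qform X).
Proof.
rewrite (_ : qform X = fun w => \sum_i \sum_k X i k * w 0 i * w 0 k); last first.
  by apply/funext => w; rewrite qformE.
apply: continuous_bigsum => i; apply: continuous_bigsum => k v.
have cc l : {for v, continuous (fun w : 'rV[R]_n => w 0 l)}.
  exact: coord_continuous.
apply: (@continuousM _ _ (cst (X i k) \* (fun w : 'rV_n => w 0 i))) => //.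
by apply: continuousM => //; exact: cst_continuous.
Qed.

End DotProduct.

(** * Diagonalization of symmetric matrices and the min-max inequalities *)

Section Spectral.
Variable R : realType.

(** The eigenvector is a maximizer of the quadratic form on the compact Euclidean unit sphere, and
    the eigenvalue is the maximum. *)
Lemma rayleigh_eigenvector n (X : 'M[R]_n.+1) : X^T = X ->
  exists (e : 'rV[R]_n.+1) (mu : R), dot e e = 1 /\ e *m X = mu *: e.
Proof.
move=> symX.
have contd : continuous (fun u : 'rV[R]_n.+1 => dot u u).
  move=> u; rewrite (_ : (fun u => _) = qform 1%:M); first exact: qform_continuous.
  by apply/funext => w; rewrite qform_scalar mul1r.
pose S := [set u : 'rV[R]_n.+1 | dot u u = 1].
have S0 : S !=set0.
  by exists (delta_mx 0 0); rewrite /S/= dot_delta mxE !eqxx.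
have clS : closed S.
  rewrite (_ : S = (fun u => dot u u) @^-1` [set 1])//.
  by apply: preimage_closed.
have bdS : bounded_set S.
  exists 1; split; first exact: num_real.
  move=> M M1 u /= uS.
  have : `|u| ^+ 2 <= 1 by rewrite -uS norm_sqr_le_dot.
  by rewrite expr_le1// => /le_trans; apply; exact: ltW.
have [e eS emax] := EVT_max_rV S0 (bounded_closed_compact bdS clS)
  (continuous_subspaceT (@qform_continuous _ _ X)).
rewrite inE /S/= in eS.
exists e, (qform X e); split=> //.
set mu := qform X e.
have psd u : 0 <= mu * dot u u - qform X u.
  have [->|u0] := eqVneq u 0; first by rewrite dot0l qform0 mulr0 subr0.
  have du0 : 0 < dot u u by rewrite lt_def dot_eq0 u0 dot_ge0.
  have := emax ((Num.sqrt (dot u u))^-1 *: u).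
  rewrite inE /S/= dotZl dotZr mulrA -expr2 exprVn sqr_sqrtr ?dot_ge0//.
  rewrite mulVf ?gt_eqF// => /(_ erefl).
  rewrite qformZ exprVn sqr_sqrtr ?dot_ge0// mulrC ler_pdivrMr//.
  by rewrite subr_ge0.
pose B := mu%:M - X.
have qB u : qform B u = mu * dot u u - qform X u.
  by rewrite /B qform_mxD qform_scalar -scaleN1r qform_mxZ mulN1r.
have symB : B^T = B by rewrite /B linearB/= symX tr_scalar_mx.
have Be0 : qform B e = 0 by rewrite qB eS mulr1 subrr.
(* [e] minimizes the nonnegative form [B], so the linear term of
   [qform B (e + t y)] vanishes. *)
suff eB : e *m B = 0.
  by move/eqP: eB; rewrite /B mulmxBr mul_mx_scalar subr_eq0 => /eqP.
apply/eqP; rewrite -dot_eq0; set y := e *m B.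
have key t : 0 <= t * (2 * dot y y) + t ^+ 2 * qform B y.
  have := psd (e + t *: y); rewrite -qB qform_dotD qformZ Be0.
  have -> : dot ((t *: y) *m B) e = t * dot y y.
    by rewrite -scalemxAl dotZl (dotC (y *m B)) dot_mxr symB.
  rewrite dotZr -/y => h; apply: le_trans h _.
  by rewrite le_eqVlt; apply/orP; left; apply/eqP; ring.
have qBy : 0 <= qform B y by rewrite qB.
have dy := dot_ge0 y.
have [//|yn0] := eqVneq (dot y y) 0.
have dy0 : 0 < dot y y by rewrite lt_def yn0.
have p0 : 0 < qform B y + 1 by lra.
(* A negative [t] at which the quadratic in [key] is negative unless [y] vanishes; the [+ 1] keeps
   the denominator positive when [qform B y] is 0. *)
have := key (- (dot y y / (qform B y + 1))).
set a := dot y y; set b := qform B y; rewrite -/a in dy0; rewrite -/b in qBy p0.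
have -> : - (a / (b + 1)) * (2 * a) + (- (a / (b + 1))) ^+ 2 * b =
   (a / (b + 1)) ^+ 2 * (- b - 2).
  by field; rewrite gt_eqF.
have sq0 : 0 < (a / (b + 1)) ^+ 2 by rewrite exprn_gt0 ?divr_gt0.
by rewrite pmulr_rge0//; lra.
Qed.

(* The reflection exchanging [e] and the first basis vector; for [e] equal to
   that vector it is the identity because [2 / 0 = 0]. *)
Lemma householder n (e : 'rV[R]_n.+1) : dot e e = 1 ->
  exists Q : 'M[R]_n.+1, [/\ Q^T = Q, Q *m Q = 1%:M & delta_mx 0 0 *m Q = e].
Proof.
move=> e1; pose e0 : 'rV[R]_n.+1 := delta_mx 0 0.
have e01 : dot e0 e0 = 1 by rewrite dot_delta mxE !eqxx.
pose w := e0 - e; pose c := 2 / dot w w.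
pose Q : 'M[R]_n.+1 := 1%:M - c *: (w^T *m w).
have act u : u *m Q = u - (c * dot u w) *: w.
  rewrite /Q mulmxBr mulmx1 -scalemxAr mulmxA.
  by rewrite (mx11_scalar (u *m w^T)) mul_scalar_mx scalerA.
have dww : dot w w = 2 * dot e0 w.
  by rewrite /w !(dotDl, dotDr, dotNl, dotNr) e01 e1 (dotC e e0); ring.
have [w0|w0] := eqVneq w 0.
  have ee : e0 = e by apply/eqP; rewrite -subr_eq0 -/w w0.
  by exists 1%:M; rewrite trmx1 !mulmx1.
have dw0 : dot w w != 0 by rewrite dot_eq0.
have QE : delta_mx 0 0 *m Q = e.
  rewrite act -/e0 (_ : c * dot e0 w = 1) ?scale1r ?/w ?subKr//.
  by rewrite /c mulrAC -dww divff.
have QT : Q^T = Q.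
  by rewrite /Q linearB linearZ /= trmx1 trmx_mul trmxK.
exists Q; split=> //; apply/row_matrixP => i; rewrite !rowE mulmxA mulmx1 !act.
rewrite dotDl dotNl dotZl -addrA -opprD -scalerDl.
set b := dot _ w; set a := dot w w.
have -> : c * b + c * (b - c * b * a) = 0.
  by rewrite /c -/a; field; rewrite -/a in dw0.
by rewrite scale0r subr0.
Qed.

(** Deflation: a reflection moves one eigenvector to the first basis vector, and induction
    diagonalizes the remaining block. The rows of [P] are orthonormal eigenvectors. *)
Lemma real_spectral n (X : 'M[R]_n) : X^T = X ->
  exists (P : 'M[R]_n) (d : 'rV[R]_n), P *m P^T = 1%:M /\ P *m X = diag_mx d *m P.
Proof.
elim: n X => [|n IH] X symX; first by exists 1%:M, 0; split; apply/matrixP => -[].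
have [e [mu [e1 eX]]] := rayleigh_eigenvector symX.
have [Q [QT QQ Qe]] := householder e1.
pose Y : 'M[R]_(1 + n) := Q *m X *m Q.
have symY : Y^T = Y by rewrite /Y !trmx_mul QT symX mulmxA.
have Y0 : (delta_mx 0 0 : 'rV_n.+1) *m Y = mu *: delta_mx 0 0.
  by rewrite /Y !mulmxA Qe eX -scalemxAl -{1}Qe -mulmxA QQ mulmx1.
have Yrow k : Y 0 k = mu * (k == 0)%:R.
  by have /rowP/(_ k) := Y0; rewrite -rowE !mxE eqxx.
pose Y' := drsubmx Y.
(* The first row is known because the first basis vector is an eigenvector of [Y]; symmetry then
   clears the first column. *)
have YE : Y = block_mx (mu%:M) 0 0 Y'.
  rewrite -(submxK Y); congr block_mx.
  - apply/matrixP => i k; rewrite [LHS]mxE [LHS]mxE !ord1 lshift0 Yrow.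
    by rewrite eqxx mulr1 mxE eqxx mulr1n.
  - by apply/matrixP => i k; rewrite [LHS]mxE [LHS]mxE !ord1 lshift0 Yrow mulr0 mxE.
  - apply/matrixP => i k; rewrite -symY [LHS]mxE [LHS]mxE mxE !ord1 lshift0 Yrow.
    by rewrite mulr0 mxE.
have symY' : Y'^T = Y' by rewrite /Y' trmx_drsub symY.
have [P' [d' [P'o P'Y]]] := IH _ symY'.
pose P1 : 'M[R]_(1 + n) := block_mx 1%:M 0 0 P'.
exists (P1 *m Q), (row_mx mu%:M d' : 'rV_(1 + n)); split.
  rewrite trmx_mul QT mulmxA -(mulmxA P1) QQ mulmx1 /P1.
  rewrite (@tr_block_mx _ 1 n 1 n) (@mulmx_block _ 1 n 1 n 1 n).
  by rewrite !trmx0 trmx1 !(mulmx0, mul0mx, mulmx1, addr0, add0r) P'o -scalar_mx_block.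
have -> : P1 *m Q *m X = P1 *m Y *m Q by rewrite /Y -!mulmxA QQ mulmx1.
rewrite [RHS]mulmxA; congr (_ *m _); rewrite {}YE /P1.
rewrite (diag_mx_row (mu%:M : 'rV_1) d') !(@mulmx_block _ 1 n 1 n 1 n).
rewrite !(mulmx0, mul0mx, mulmx1, mul1mx, addr0, add0r) P'Y.
rewrite (_ : diag_mx (mu%:M : 'rV_1) = mu%:M)//.
by apply/matrixP => i k; rewrite !ord1 !mxE !eqxx !mulr1n.
Qed.

Lemma char_poly_spectral n (X P : 'M[R]_n) (d : 'rV[R]_n) :
  P *m P^T = 1%:M -> P *m X = diag_mx d *m P ->
  char_poly X = \prod_i ('X - (d 0 i)%:P).
Proof.
move=> Po PX.
have Pn0 : \det (map_mx (@polyC R) P) != 0.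
  rewrite det_map_mx polyC_eq0; apply/eqP => P0.
  have := congr1 determinant Po; rewrite det_mulmx P0 mul0r det1 => /esym/eqP.
  by rewrite oner_eq0.
apply: (mulfI Pn0); rewrite /char_poly -det_mulmx /char_poly_mx mulmxBr.
rewrite mul_mx_scalar -map_mxM/= PX map_mxM/= -mul_scalar_mx -mulmxBl det_mulmx.
rewrite mulrC; congr (_ * _).
have := @char_poly_trig R n (diag_mx d) (diag_mx_is_trig d).
rewrite /char_poly /char_poly_mx => ->; apply: eq_bigr => i _.
by rewrite mxE eqxx mulr1n.
Qed.

(** The choice made by [xget] is forced: the polynomial determines the multiset of its roots, and
    sortedness then determines the list. *)
Lemma ordered_eigenvalues_spectral n (X P : 'M[R]_n) (d : 'rV[R]_n) :
  P *m P^T = 1%:M -> P *m X = diag_mx d *m P ->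
  ordered_eigenvalues X = sort <=%R [seq d 0 i | i <- enum 'I_n].
Proof.
move=> Po PX; have cpE := char_poly_spectral Po PX.
rewrite /ordered_eigenvalues; apply: xget_unique.
  split; first exact/sort_sorted/le_total.
  rewrite cpE -big_enum/= -(big_map (fun i => d 0 i) predT (fun a => 'X - a%:P)).
  by apply: perm_big; rewrite perm_sym perm_sort.
move=> s [ss sE]; apply: (sorted_eq le_trans le_anti) => //.
  exact/sort_sorted/le_total.
rewrite perm_sym perm_sort perm_sym; apply: prod_XsubC_eq; rewrite -sE cpE.
by rewrite big_map -big_enum.
Qed.

Lemma count_le_nth (s : seq R) k : sorted <=%R s -> (k < size s)%N ->
  (k < count (fun a => (a <= nth 0 s k)%R) s)%N.
Proof.
move=> ss ks; rewrite -{2}(cat_take_drop k.+1 s) count_cat.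
apply: leq_trans (leq_addr _ _).
suff : all (fun a => a <= nth 0 s k) (take k.+1 s).
  by rewrite all_count => /eqP ->; rewrite size_takel.
apply/(all_nthP 0) => i; rewrite size_takel// => ik; rewrite nth_take//.
by apply: (sorted_leq_nth le_trans lexx) => //; rewrite inE (leq_trans ik).
Qed.

Lemma count_ge_nth (s : seq R) k : sorted <=%R s -> (k < size s)%N ->
  (size s - k <= count (fun a => (nth 0 s k <= a)%R) s)%N.
Proof.
move=> ss ks; rewrite -{3}(cat_take_drop k s) count_cat.
apply: leq_trans (leq_addl _ _).
suff : all (fun a => nth 0 s k <= a) (drop k s).
  by rewrite all_count => /eqP ->; rewrite size_drop.
apply/(all_nthP 0) => i; rewrite size_drop => ik; rewrite nth_drop.
apply: (sorted_leq_nth le_trans lexx) => //; rewrite ?inE ?leq_addr//.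
by rewrite -ltn_subRL.
Qed.

(** Counting indices of the diagonalization takes care of multiplicities. The second bound is strict
    because lambda_j sits at position [j.-1] of the list. *)
Lemma card_eigenvalues n j (X P : 'M[R]_n) (d : 'rV[R]_n) (hj : (1 <= j <= n)%N) :
  P *m P^T = 1%:M -> P *m X = diag_mx d *m P ->
  (j <= #|[set i | (d 0 i <= lambda j X)%R]%SET|)%N /\
  (n - j < #|[set i | (lambda j X <= d 0 i)%R]%SET|)%N.
Proof.
move=> Po PX; have/andP[j0 jn] := hj.
have sE := ordered_eigenvalues_spectral Po PX.
have ssz : size (ordered_eigenvalues X) = n.
  by rewrite sE size_sort size_map size_enum_ord.
have ss : sorted <=%R (ordered_eigenvalues X) by rewrite sE; exact/sort_sorted/le_total.
have ks : (j.-1 < size (ordered_eigenvalues X))%N by rewrite ssz prednK.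
have cnt (p : pred R) : count p (ordered_eigenvalues X) = #|[set i | p (d 0 i)]%SET|.
  rewrite sE; have /permP -> : perm_eq (sort <=%R [seq d 0 i | i <- enum 'I_n])
    [seq d 0 i | i <- enum 'I_n] by rewrite perm_sort.
  rewrite count_map cardE -size_filter /enum_mem; congr size.
  by rewrite -filter_predI; apply: eq_filter => i /=; rewrite !inE andbT.
have := count_le_nth ss ks; have := count_ge_nth ss ks.
rewrite ssz !cnt prednK// => h1 h2; split=> //.
by apply: leq_trans h1; rewrite -ltnS -subSn//; case: (j) j0.
Qed.

Lemma qform_spectral n (X P : 'M[R]_n) (d h : 'rV[R]_n) :
  P *m P^T = 1%:M -> P *m X = diag_mx d *m P ->
  let k := h *m P^T in
  qform X h = \sum_i d 0 i * k 0 i ^+ 2 /\ dot h h = \sum_i k 0 i ^+ 2.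
Proof.
move=> Po PX k; have hE : h = k *m P by rewrite /k -mulmxA (mulmx1C Po) mulmx1.
split.
  rewrite /qform [in h *m X]hE -mulmxA PX mulmxA dotC dot_mxr -/k dotC.
  by rewrite dotE; apply: eq_bigr => i _; rewrite mul_mx_diag mxE; ring.
by rewrite {1}hE dotC dot_mxr -/k dotE; apply: eq_bigr => i _; rewrite expr2.
Qed.

Lemma lambda_min_max n j (X : 'M[R]_n) : (1 <= j <= n)%N -> X^T = X ->
  exists V : {vspace 'rV[R]_n}, \dim V = j /\
    forall h, h \in V -> qform X h <= lambda j X * dot h h.
Proof.
move=> hj symX; have [P [d [Po PX]]] := real_spectral symX.
have [cardT _] := card_eigenvalues hj Po PX.
set T := [set i | (d 0 i <= lambda j X)%R]%SET in cardT.
pose s := take j (enum T).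
have ssz : size s = j by rewrite size_takel// -cardE.
have sT i : i \in s -> d 0 i <= lambda j X.
  by move=> /mem_take; rewrite mem_enum inE.
have su : uniq s by rewrite take_uniq// enum_uniq.
have PP i k : dot (row i P) (row k P) = (i == k)%:R.
  have /matrixP/(_ i k) := Po; rewrite !mxE dotE => <-.
  by apply: eq_bigr => l _; rewrite !mxE.
pose vs := [seq row i P | i <- s].
have fvs : free vs.
  rewrite -[vs]in_tupleE; apply/freeP => k k0 i.
  have ltis : (i < size s)%N by rewrite -(size_map (fun i => row i P)).
  have [i0 _] : exists i0, i0 \in s.
    by exists (tnth (in_tuple s) (Ordinal ltis)); rewrite mem_tnth.
  have := congr1 (fun u => dot u vs`_i) k0; rewrite dot0l.
  rewrite (big_morph (fun u => dot u vs`_i) (fun u v => dotDl u v _) (dot0l _)).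
  rewrite (bigD1 i)//= big1 => [|l li].
    by rewrite addr0 dotZl (nth_map i0)// PP eqxx mulr1.
  have ltls : (l < size s)%N by rewrite -(size_map (fun i => row i P)).
  have li' : (l == i :> nat) = false by apply/negP/negP.
  by rewrite dotZl !(nth_map i0)// PP nth_uniq// li' mulr0.
exists <<vs>>%VS; split; first by move/eqP: fvs; rewrite size_map ssz.
move=> h hV.
have out i : i \notin s -> (h *m P^T) 0 i = 0.
  move=> iS; have -> : (h *m P^T) 0 i = dot h (row i P).
    by rewrite /dot !mxE; apply: eq_bigr => l _; rewrite !mxE.
  rewrite (@coord_span _ _ _ (in_tuple vs) h hV).
  rewrite (big_morph (fun u => dot u (row i P)) (fun u v => dotDl u v _) (dot0l _)).
  apply: big1 => l _; rewrite dotZl.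
  have /mapP[m ms ->] : vs`_l \in vs by rewrite mem_nth.
  rewrite PP (_ : (m == i) = false) ?mulr0//.
  by apply/eqP => mi; rewrite -mi ms in iS.
have [-> ->] := qform_spectral h Po PX; rewrite mulr_sumr; apply: ler_sum => i _.
have [iS|iS] := boolP (i \in s).
  by rewrite ler_wpM2r ?sqr_ge0// sT.
by rewrite out// expr0n/= !mulr0.
Qed.

(** Fewer than [j] eigenvalues lie below lambda_j, so requiring the corresponding coordinates to
    vanish imposes fewer than [j] linear conditions on [V] and leaves a nonzero vector. *)
Lemma lambda_max_min n j (X : 'M[R]_n) (V : {vspace 'rV[R]_n}) :
  (1 <= j <= n)%N -> X^T = X -> \dim V = j ->
  exists h, [/\ h \in V, h != 0 & lambda j X * dot h h <= qform X h].
Proof.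
move=> hj symX dV; have [P [d [Po PX]]] := real_spectral symX.
have [_ cardT] := card_eigenvalues hj Po PX.
set T := [set i | (lambda j X <= d 0 i)%R]%SET in cardT.
pose M : 'M[R]_n := P^T *m diag_mx (\row_i (i \notin T)%:R).
(* [f] keeps the eigencoordinates outside [T]; the vector sought lies in its kernel. *)
pose f : 'Hom('rV[R]_n, 'rV[R]_n) := linfun (mulmxr M).
have fE h i : f h 0 i = (i \notin T)%:R * (h *m P^T) 0 i.
  by rewrite lfunE /= /M mulmxA mul_mx_diag !mxE mulrC.
have dimf : (\dim (f @: V) < j)%N.
  pose es := [seq delta_mx 0 i : 'rV[R]_n | i <- enum (~: T)].
  have /dimvS/leq_ltn_trans : (f @: V <= <<es>>)%VS.
    apply/subvP => _ /memv_imgP[h _ ->].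
    rewrite (row_sum_delta (f h)); apply: memv_suml => i _.
    have [iT|iT] := boolP (i \in T); first by rewrite fE iT mul0r scale0r mem0v.
    by rewrite memvZ// memv_span// map_f// mem_enum inE.
  apply; apply: leq_ltn_trans (dim_span _) _; rewrite size_map -cardE.
  rewrite cardsCs finset.setCK card_ord.
  have := max_card (mem T); rewrite card_ord.
  by case/andP: hj; move: cardT; clear; lia.
have := limg_ker_dim f V; rewrite dV => dimE.
have dk : (0 < \dim (V :&: lker f))%N.
  by rewrite lt0n; apply/eqP => k0; move: dimE dimf; rewrite k0 add0n => ->; rewrite ltnn.
pose h := vpick (V :&: lker f)%VS.
have /andP[hV hk] : (h \in V) && (h \in lker f) by rewrite -memv_cap memv_pick.
exists h; split=> //; first by rewrite vpick0 -dimv_eq0 -lt0n.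
have out i : i \notin T -> (h *m P^T) 0 i = 0.
  move=> iT; have := fE h i; rewrite (eqP (_ : f h == 0)) -?memv_ker// iT mul1r => <-.
  by rewrite mxE.
have [-> ->] := qform_spectral h Po PX; rewrite mulr_sumr; apply: ler_sum => i _.
have [iT|iT] := boolP (i \in T).
  by rewrite ler_wpM2r ?sqr_ge0//; rewrite inE in iT.
by rewrite out// expr0n/= !mulr0.
Qed.

End Spectral.

(** * Second-order Taylor expansion and test functions *)

Section Calculus.
Variables (R : realType) (n : nat).
Implicit Types (f : 'rV[R]_n -> R) (x y h v : 'rV[R]_n).

Lemma nbhs_radius x (P : set 'rV[R]_n) : (\forall y \near x, P y) ->
  exists2 r : R, 0 < r & forall h, `|h| < r -> P (x + h).
Proof.
move=> /nbhs_ballP[r r0 rP]; exists r => // h hr; apply: rP.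
by rewrite -ball_normE/= opprD addrA subrr add0r normrN.
Qed.

Lemma near_forall_ord x (P : 'I_n -> set 'rV[R]_n) :
  (forall i, \forall y \near x, P i y) -> \forall y \near x, forall i, P i y.
Proof.
move=> xP; near=> y => i; move: i; near: y.
by apply: filter_forall => i; exact: xP.
Unshelve. all: by end_near. Qed.

Lemma is_derive_eps f x v (d : R) :
  (forall e : R, 0 < e -> exists2 r : R, 0 < r & forall t : R, `|t| < r ->
     `|f (x + t *: v) - f x - t * d| <= e * `|t|) -> is_derive x v f d.
Proof.
move=> fd.
suff cv : (fun t => t^-1 *: ((f \o shift x) (t *: v) - f x)) @ (0 : R)^' --> d.
  split; first by apply/cvg_ex; exists d.
  exact: cvg_lim.
apply/cvgrPdist_le => e e0; have [r r0 rf] := fd e e0.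
near=> t.
have t0 : t != 0 by near: t; exact: nbhs_dnbhs_neq.
have tr : `|t| < r.
  near: t; apply: dnbhs0_lt => //.
rewrite /= (addrC (t *: v)) distrC.
have -> : t^-1 *: (f (x + t *: v) - f x) - d = t^-1 * (f (x + t *: v) - f x - t * d).
  by rewrite [RHS]mulrBr mulKf.
by rewrite normrM normfV ler_pdivrMl ?normr_gt0// [leRHS]mulrC rf.
Unshelve. all: by end_near. Qed.

Lemma is_derive_line f x v (t d : R) : is_derive (x + t *: v) v f d ->
  is_derive t 1 (fun s : R => f (x + s *: v)) d.
Proof.
move=> [df <-]; have E : (fun h : R => h^-1 *: (((fun s : R => f (x + s *: v)) \o shift t) (h *: 1)
      - f (x + t *: v))) =
    (fun h : R => h^-1 *: ((f \o shift (x + t *: v)) (h *: v) - f (x + t *: v))).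
  apply/funext => h /=; congr (_ *: (f _ - _)).
  by rewrite [h *: 1]mulr1 scalerDl addrCA.
by split; rewrite /derivable /derive E.
Qed.

(** The increment [c] may have either sign; the intermediate time is controlled in absolute value
    only, which suffices for estimates in balls. *)
Lemma MVT_line f x v (c : R) :
  (forall t : R, `|t| <= `|c| -> derivable f (x + t *: v) v) ->
  exists2 t : R, `|t| <= `|c| & f (x + c *: v) - f x = c * 'D_v f (x + t *: v).
Proof.
move=> df; pose g (s : R) := f (x + s *: v).
have dg (t : R) : `|t| <= `|c| -> is_derive t 1 g ('D_v f (x + t *: v)).
  by move=> tc; apply/is_derive_line/derivableP/df.
have gc (a b : R) : (forall t, t \in `[a, b] -> `|t| <= `|c|) ->
    {within `[a, b], continuous g}.
  by move=> abc; apply: derivable_within_continuous => t /abc /dg [].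
have g0 : g 0 = f x by rewrite /g scale0r addr0.
have [c0|c0|->] := ltgtP c 0; last first.
- by exists 0; rewrite ?normr0// scale0r addr0 subrr mul0r.
- have sub t : t \in `[0, c] -> `|t| <= `|c|.
    by rewrite in_itv/= => /andP[t0 tc]; rewrite !ger0_norm// ltW.
  have [t tI E] := @MVT R g _ 0 c c0 (fun t tI => dg t (sub t (subset_itv_oo_cc tI))) (gc _ _ sub).
  exists t; first exact/sub/subset_itv_oo_cc.
  by rewrite -g0 -/(g c) E subr0 mulrC.
- have sub t : t \in `[c, 0] -> `|t| <= `|c|.
    by rewrite in_itv/= => /andP[t0 tc]; rewrite !ler0_norm ?lerN2// ltW.
  have [t tI E] := @MVT R g _ c 0 c0 (fun t tI => dg t (sub t (subset_itv_oo_cc tI))) (gc _ _ sub).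
  exists t; first exact/sub/subset_itv_oo_cc.
  by rewrite -g0 -/(g c) -opprB E sub0r; ring.
Qed.

Definition grad f x : 'rV[R]_n := \row_i pderiv i f x.

Lemma sum_average_le (e c : R) : 0 <= e -> 0 <= c ->
  \sum_(i < n) e / (n%:R + 1) * c <= e * c.
Proof.
move=> e0 c0; rewrite sumr_const card_ord -[leLHS]mulr_natl.
set m := n%:R; have m0 : 0 <= m by rewrite /m.
rewrite (_ : m * _ = m / (m + 1) * (e * c)); last by rewrite !mulrA; congr (_ * _); ring.
by rewrite ler_piMl ?mulr_ge0// ler_pdivrMr ?mul1r ?lerDl// ltr_wpDl.
Qed.

(** The increment is performed one coordinate at a time, with the mean value theorem for each; the
    intermediate points stay in the sup-norm ball of radius [|h|]. The tolerance [e / (n + 1)] makes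
    the sum of the [n] errors at most [e * |h|] and is meaningful for [n = 0] too. *)
Lemma first_order f x :
  (\forall y \near x, forall i, derivable f y (delta_mx 0 i)) ->
  (forall i, {for x, continuous (pderiv i f)}) ->
  forall e : R, 0 < e -> exists2 r : R, 0 < r & forall h, `|h| < r ->
    `|f (x + h) - f x - dot h (grad f x)| <= e * `|h|.
Proof.
move=> df cf e e0; pose e' := e / (n%:R + 1).
have n0 : 0 < n%:R + 1 :> R by rewrite ltr_wpDl.
have e'0 : 0 < e' by rewrite divr_gt0.
have near_e : \forall y \near x, forall i, `|pderiv i f x - pderiv i f y| <= e'.
  by apply: near_forall_ord => i; have /cvgrPdist_le := cf i; apply.
have [r r0 rP] := nbhs_radius (filterI df near_e).
exists r => // h hr; pose T (k : nat) : 'rV[R]_n := \row_(i < n) (if (i < k)%N then h 0 i else 0).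
have Tle (k : 'I_n) (t : R) : `|t| <= `|h 0 k| -> `|T k + t *: delta_mx 0 k| <= `|h|.
  move=> th; apply: norm_leP => // i; rewrite !mxE eqxx/=.
  have [->|ik] := eqVneq i k.
    by rewrite ltnn add0r mulr1 (le_trans th)// coord_norm_le.
  rewrite mulr0 addr0; case: ifP => _; last by rewrite normr0.
  exact: coord_norm_le.
have TS (k : 'I_n) : T k.+1 = T k + h 0 k *: delta_mx 0 k.
  apply/rowP => i; rewrite !mxE eqxx/=.
  have [->|ik] := eqVneq i k; first by rewrite ltnSn ltnn add0r mulr1.
  rewrite mulr0 addr0 ltnS leq_eqVlt (_ : (i == k :> nat) = false)//.
  exact/negP/negP.
have step (k : 'I_n) :
  `|f (x + T k.+1) - f (x + T k) - h 0 k * pderiv k f x| <= e' * `|h|.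
  have [t th H] : exists2 t : R, `|t| <= `|h 0 k| &
    f (x + T k + h 0 k *: delta_mx 0 k) - f (x + T k) =
    h 0 k * 'D_(delta_mx 0 k) f (x + T k + t *: delta_mx 0 k).
    apply: MVT_line => t th; rewrite -addrA.
    by apply: (rP _ _).1; exact: le_lt_trans (Tle k t th) hr.
  have -> : x + T k.+1 = x + T k + h 0 k *: delta_mx 0 k by rewrite -addrA TS.
  rewrite {}H -addrA -mulrBr normrM mulrC ler_pM ?coord_norm_le//.
  rewrite distrC; apply: (rP _ _).2; exact: le_lt_trans (Tle k t th) hr.
have T0 : T 0%N = 0 by apply/rowP => i; rewrite !mxE.
have Tn : T n = h by apply/rowP => i; rewrite !mxE ltn_ord.
have -> : f (x + h) - f x - dot h (grad f x) =
   \sum_(k < n) (f (x + T k.+1) - f (x + T k) - h 0 k * pderiv k f x).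
  rewrite sumrB -(big_mkord xpredT (fun k => f (x + T k.+1) - f (x + T k))).
  rewrite telescope_sumr// T0 Tn addr0 dotE; congr (_ - _).
  by apply: eq_bigr => k _; rewrite mxE.
apply: le_trans (ler_norm_sum _ _ _) _.
apply: (@le_trans _ _ (\sum_(k < n) e' * `|h|)); first exact: ler_sum.
exact: sum_average_le (ltW e0) (normr_ge0 h).
Qed.

Lemma derive_grad f x v :
  (\forall y \near x, forall i, derivable f y (delta_mx 0 i)) ->
  (forall i, {for x, continuous (pderiv i f)}) ->
  is_derive x v f (dot v (grad f x)).
Proof.
move=> df cf; apply: is_derive_eps => e e0.
have v0 : 0 < `|v| + 1 by rewrite ltr_wpDl.
have [r r0 rP] := first_order df cf (divr_gt0 e0 v0).
exists (r / (`|v| + 1)); first by rewrite divr_gt0.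
move=> t tr; have tv : `|t *: v| < r.
  rewrite normrZ; apply: le_lt_trans (_ : `|t| * (`|v| + 1) < r).
    by rewrite ler_wpM2l// lerDl.
  by rewrite -ltr_pdivlMr.
have := rP _ tv; rewrite dotZl => /le_trans; apply.
rewrite normrZ mulrAC ler_pdivrMr// -mulrA ler_wpM2l ?(ltW e0)//.
by rewrite ler_wpM2l// lerDl.
Qed.

(** * Symmetry of the Hessian and the second-order expansion *)

Section C2.
Variables (U : set 'rV[R]_n) (f : 'rV[R]_n -> R) (x : 'rV[R]_n).
Hypotheses (oU : open U) (fC2 : C2_on U f) (Ux : U x).

Lemma C2_near : \forall y \near x, U y.
Proof. exact: open_nbhs_nbhs. Qed.

Lemma C2_derive y v : U y -> is_derive y v f (dot v (grad f y)).
Proof.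
move=> Uy; apply: derive_grad => [|i]; last by have [] := fC2 i i Uy.
apply: filterS (open_nbhs_nbhs (conj oU Uy)) => z Uz i.
by have [] := fC2 i i Uz.
Qed.

Lemma grad_expand (e : R) : 0 < e ->
  exists2 r : R, 0 < r & forall h, `|h| < r -> U (x + h) /\ forall i,
    `|pderiv i f (x + h) - pderiv i f x - \sum_k hessian f x i k * h 0 k| <= e * `|h|.
Proof.
move=> e0.
have near_e : \forall y \near x, U y /\ forall i,
    `|pderiv i f y - pderiv i f x - \sum_k hessian f x i k * (y - x) 0 k| <= e * `|y - x|.
  apply: filterI; first exact: C2_near.
  apply: near_forall_ord => i.
  have [||r r0 rP] := @first_order (pderiv i f) x _ _ _ e0.
  - by apply: filterS C2_near => y Uy k; have [] := fC2 i k Uy.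
  - by move=> k; have [] := fC2 i k Ux.
  apply/nbhs_ballP; exists r => //= y; rewrite -ball_normE/= => xyr.
  have /rP : `|y - x| < r by rewrite distrC.
  rewrite addrCA subrr addr0 dotE => h; congr (`| _ - _ | <= _) : h.
  by apply: eq_bigr => k _; rewrite !mxE mulrC.
have [r r0 rP] := nbhs_radius near_e; exists r => // h /rP.
by rewrite (addrC x) addrK.
Qed.

(** The second difference of [f] is symmetric in [i] and [k], while the approximating entry is not
    visibly so; this is the source of [hessian_sym]. *)
Lemma second_difference (i k : 'I_n) (e : R) : 0 < e ->
  exists2 r : R, 0 < r & forall s : R, 0 < s -> s < r ->
    `|f (x + s *: delta_mx 0 i + s *: delta_mx 0 k) - f (x + s *: delta_mx 0 k)
      - (f (x + s *: delta_mx 0 i) - f x) - s ^+ 2 * hessian f x i k| <= e * s ^+ 2.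
Proof.
(* The gradient is expanded at two increments, of norm at most [s] and [2 * s]: hence the third of
   [e] here and the radius [r / 2] below. *)
move=> e0; have e30 : 0 < e / 3 by rewrite divr_gt0.
have [r r0 rP] := grad_expand e30.
exists (r / 2); first by rewrite divr_gt0.
move=> s s0 sr; pose ei : 'rV[R]_n := delta_mx 0 i; pose ek : 'rV[R]_n := delta_mx 0 k.
rewrite -/ei -/ek.
have nd l : `|delta_mx 0 l : 'rV[R]_n| <= 1.
  apply: norm_leP => // m; rewrite mxE eqxx/=.
  by case: (m == l); rewrite ?normr1 ?normr0.
pose F y := f (y + s *: ek) - f y.
have small (t : R) : `|t| <= `|s| -> `|t *: ei| <= s /\ `|t *: ei + s *: ek| <= 2 * s.
  rewrite (gtr0_norm s0) => ts.
  have A : `|t *: ei| <= s by rewrite normrZ -(mulr1 s) ler_pM ?nd.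
  split=> //; apply: le_trans (ler_normD _ _) _.
  rewrite mulr_natl mulr2n lerD// normrZ gtr0_norm// -{2}(mulr1 s).
  by apply: ler_wpM2l; [exact: ltW|exact: nd].
have in_r (t : R) : `|t| <= `|s| -> `|t *: ei| < r /\ `|t *: ei + s *: ek| < r.
  by move=> /small[A B]; split; [apply: le_lt_trans A _|apply: le_lt_trans B _]; lra.
have dF (t : R) : `|t| <= `|s| ->
    is_derive (x + t *: ei) ei F
      (pderiv i f (x + (t *: ei + s *: ek)) - pderiv i f (x + t *: ei)).
  move=> /in_r[A B]; have [UA _] := rP _ A; have [UB _] := rP _ B.
  have [dA _ _ _] := fC2 i i UA.
  apply: is_deriveB; last exact: derivableP.
  rewrite addrA in UB *; have [dB _ _ _] := fC2 i i UB.
  have [cB vB] := derivableP dB.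
  have E : (fun h : R => h^-1 *: (((fun y => f (y + s *: ek)) \o shift (x + t *: ei)) (h *: ei)
      - f (x + t *: ei + s *: ek))) =
    (fun h : R => h^-1 *: ((f \o shift (x + t *: ei + s *: ek)) (h *: ei) - f (x + t *: ei + s *: ek))).
    by apply/funext => h /=; congr (_ *: (f _ - _)); rewrite -!addrA.
  by split; rewrite /derivable /derive E.
have [t ts FE] := @MVT_line F x ei s (fun t ts => @ex_derive _ _ _ _ _ _ _ (dF t ts)).
have [A B] := small t ts; have [rA rB] := in_r t ts.
have [_ /(_ i) HA] := rP _ rA; have [_ /(_ i) HB] := rP _ rB.
have -> : f (x + s *: ei + s *: ek) - f (x + s *: ek) - (f (x + s *: ei) - f x) =
    s * (pderiv i f (x + (t *: ei + s *: ek)) - pderiv i f (x + t *: ei)).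
  by have [_ <-] := dF t ts; rewrite -FE /F; ring.
have hs : \sum_l hessian f x i l * (t *: ei + s *: ek) 0 l =
    \sum_l hessian f x i l * (t *: ei) 0 l + s * hessian f x i k.
  rewrite (eq_bigr (fun l => hessian f x i l * (t *: ei) 0 l +
    hessian f x i l * (s *: ek) 0 l)) => [|l _]; last by rewrite [X in _ * X]mxE mulrDr.
  rewrite big_split/=; congr (_ + _); rewrite (bigD1 k)//= big1 => [|l lk].
    by rewrite !mxE !eqxx mulr1 addr0 mulrC.
  by rewrite !mxE (negPf lk) andbF !mulr0.
rewrite hs in HB; rewrite expr2 -mulrA -mulrBr normrM gtr0_norm// mulrCA ler_pM2l//.
set a := pderiv i f (x + (_ + _)) in HB *; set b := pderiv i f (x + t *: ei) in HA *.
set S := \sum_l _ in HA HB; set p := pderiv i f x in HA HB.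
have -> : a - b - s * hessian f x i k =
  (a - p - (S + s * hessian f x i k)) - (b - p - S) by ring.
apply: le_trans (ler_normB _ _) _.
apply: le_trans (lerD HB HA) _.
rewrite -mulrDr -mulrA ler_wpM2l ?(ltW e0)// mulrC ler_pdivrMr//; lra.
Qed.

Lemma hessian_sym : (hessian f x)^T = hessian f x.
Proof.
apply/matrixP => i k; rewrite mxE; apply/eqP; rewrite -subr_eq0 -normr_le0.
apply/ler_addgt0Pl => e e0; rewrite addr0.
have e20 : 0 < e / 2 by rewrite divr_gt0.
have [r1 r10 H1] := second_difference i k e20.
have [r2 r20 H2] := second_difference k i e20.
pose s := Num.min r1 r2 / 2.
have m0 : 0 < Num.min r1 r2 by rewrite lt_min r10.
have s0 : 0 < s by rewrite divr_gt0.
have [s1 s2] : s < r1 /\ s < r2.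
  have : s < Num.min r1 r2 by rewrite /s; lra.
  by rewrite lt_min => /andP[].
have := H1 s s0 s1; have := H2 s s0 s2; rewrite (addrAC x).
set ei := s *: delta_mx 0 i; set ek := s *: delta_mx 0 k.
set a := f _; set b := f (x + ei); set c := f (x + ek); set d := f x.
set hik := hessian f x i k; set hki := hessian f x k i => K1 K2.
have s20 : 0 < s ^+ 2 by rewrite exprn_gt0.
rewrite -(ler_pM2l s20) -(gtr0_norm s20) -normrM (gtr0_norm s20).
have -> : s ^+ 2 * (hki - hik) =
   (a - c - (b - d) - s ^+ 2 * hik) - (a - b - (c - d) - s ^+ 2 * hki) by ring.
apply: le_trans (ler_normB _ _) _; apply: le_trans (lerD K2 K1) _.
by rewrite le_eqVlt; apply/orP; left; apply/eqP; field.
Qed.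

(** One mean value theorem on the segment, applied to [f] minus its quadratic approximation: the
    derivative of the difference is [h] paired with the first-order remainder of the gradient, so
    the error is quadratic in [|h|]. *)
Lemma taylor2 (e : R) : 0 < e ->
  exists2 r : R, 0 < r & forall h, `|h| < r -> U (x + h) /\
    `|f (x + h) - f x - dot h (grad f x) - qform (hessian f x) h / 2| <= e * `|h| ^+ 2.
Proof.
move=> e0; have n0 : 0 < n%:R + 1 :> R by rewrite ltr_wpDl.
have [r r0 rP] := grad_expand (divr_gt0 e0 n0).
exists r => // h hr; split; first by have [] := rP _ hr.
set b := grad f x; set H := hessian f x.
pose g (t : R) := f (x + t *: h) - t * dot h b - t ^+ 2 * (qform H h / 2).
pose dg (t : R) := dot h (grad f (x + t *: h)) - dot h b - t * qform H h.
have inr (t : R) : t \in `[0, 1] -> `|t *: h| < r.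
  rewrite in_itv/= => /andP[t0 t1]; rewrite normrZ ger0_norm//.
  by apply: le_lt_trans hr; rewrite ler_piMl.
have gd (t : R) : t \in `[0, 1] -> is_derive t 1 g (dg t).
  move=> /inr tr; have [Ut _] := rP _ tr.
  have d1 := is_derive_line (C2_derive h Ut).
  have d2 : is_derive t 1 (fun s : R => s * dot h b) (dot h b).
    by apply: is_derive_eq; rewrite /GRing.scale/=; ring.
  have d3 : is_derive t 1 (fun s : R => s ^+ 2 * (qform H h / 2)) (t * qform H h).
    by apply: is_derive_eq; rewrite /GRing.scale/=; field.
  exact: is_deriveB.
have gc : {within `[0, 1], continuous g}.
  by apply: derivable_within_continuous => t /gd [].
have [t tI E] := @MVT R g dg 0 1 ltr01 (fun t tI => gd t (subset_itv_oo_cc tI)) gc.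
have -> : f (x + h) - f x - dot h b - qform H h / 2 = dg t.
  move: E; rewrite subr0 mulr1 => <-; rewrite /g scale1r scale0r addr0; ring.
have tI' := subset_itv_oo_cc tI; have tr := inr t tI'.
have [_ HP] := rP _ tr.
have -> : dg t = \sum_i h 0 i * (pderiv i f (x + t *: h) - pderiv i f x
    - \sum_k H i k * (t *: h) 0 k).
  rewrite /dg qformE !dotE mulr_sumr -!sumrB; apply: eq_bigr => i _.
  rewrite !mulrBr !mxE; congr (_ - _); rewrite !mulr_sumr.
  by apply: eq_bigr => k _; rewrite !mxE; ring.
apply: le_trans (ler_norm_sum _ _ _) _.
apply: (@le_trans _ _ (\sum_(i < n) e / (n%:R + 1) * `|h| ^+ 2)).
  apply: ler_sum => i _; rewrite normrM expr2 mulrCA ler_pM ?coord_norm_le//.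
  apply: le_trans (HP i) _; rewrite ler_wpM2l ?divr_ge0 ?(ltW e0) ?(ltW n0)//.
  move: tI'; rewrite in_itv/= => /andP[t0 t1].
  by rewrite normrZ ger0_norm// ler_piMl.
by apply: sum_average_le; [exact: ltW|exact: sqr_ge0].
Qed.

End C2.

(** On a line the test function below and its partial derivatives are polynomials of degree at most
    four, so derivatives can be read off as the coefficient of [t]. *)
Lemma is_derive_quartic f y v (d k0 k1 k2 : R) :
  (forall t, f (y + t *: v) = f y + t * d + t ^+ 2 * (k0 + k1 * t + k2 * t ^+ 2)) ->
  is_derive y v f d.
Proof.
move=> fE; pose g (t : R) := f y + t * d + t ^+ 2 * (k0 + k1 * t + k2 * t ^+ 2).
have [dg vg] : is_derive (0 : R) 1 g d.
  by apply: is_derive_eq; rewrite /GRing.scale/=; ring.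
have E : (fun h : R => h^-1 *: ((f \o shift y) (h *: v) - f y)) =
    (fun h : R => h^-1 *: ((g \o shift 0) (h *: 1) - g 0)).
  apply/funext => h /=; rewrite (addrC (h *: v)) fE [h *: 1]mulr1 addr0 /g; congr (_ *: _).
  by ring.
by split; rewrite /derivable /derive E.
Qed.

(** * Polynomial test functions with a prescribed 2-jet *)

Section TestFunction.
Variables (c C : R) (b x : 'rV[R]_n) (A : 'M[R]_n).
Hypothesis symA : A^T = A.

Let coordD (w : 'rV[R]_n) (t : R) i k :
  (w + t *: delta_mx 0 k) 0 i = w 0 i + (k == i)%:R * t.
Proof. by rewrite !mxE eqxx/= eq_sym mulrC. Qed.

Let coordDr (w : 'rV[R]_n) (t : R) i k : (w + t *: row k A) 0 i = w 0 i + t * A k i.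
Proof. by rewrite !mxE. Qed.

(** The sum of fourth powers of coordinates is a polynomial with zero Hessian at [x], and it
    dominates the fourth power of the sup norm. *)
Definition quartic_test y : R :=
  c + dot b (y - x) + qform A (y - x) + C * \sum_i (y - x) 0 i ^+ 4.

Let D i y := b 0 i + 2 * ((y - x) *m A) 0 i + 4 * C * (y - x) 0 i ^+ 3.

Let is_derive_test y i : is_derive y (delta_mx 0 i) quartic_test (D i y).
Proof.
pose w := y - x.
apply: (@is_derive_quartic _ _ _ _ (A i i + C * 6 * w 0 i ^+ 2) (C * 4 * w 0 i) C) => t.
rewrite /quartic_test /D (addrAC y) -/w dotDr dotZr dot_delta qform_dotD qformZ.
have -> : qform A (delta_mx 0 i) = A i i by rewrite /qform dot_delta -rowE mxE.
rewrite -scalemxAl dotZl dotZr (dotC (delta_mx 0 i *m A)) dot_mxr symA dot_delta.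
rewrite (bigD1 i)//= [in RHS](bigD1 i)//=.
rewrite (eq_bigr (fun k => w 0 k ^+ 4)) => [|k ki]; last first.
  by rewrite coordD eq_sym (negPf ki) mul0r addr0.
by rewrite coordD eqxx mul1r; ring.
Qed.

Let pderiv_test i : pderiv i quartic_test = D i.
Proof. by apply/funext => y; have [_] := is_derive_test y i. Qed.

Let is_derive2_test y i k :
  is_derive y (delta_mx 0 k) (D i) (2 * A i k + (k == i)%:R * (12 * C * (y - x) 0 i ^+ 2)).
Proof.
pose w := y - x.
apply: (@is_derive_quartic _ _ _ _ ((k == i)%:R * 12 * C * w 0 i) ((k == i)%:R * 4 * C) 0) => t.
rewrite /D (addrAC y) -/w mulmxDl -scalemxAl -rowE.
have -> : A i k = A k i by rewrite -{1}symA mxE.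
by rewrite coordD coordDr; case: (k == i); rewrite ?(mul1r, mul0r, addr0); ring.
Qed.

Let coord_sub_continuous i : continuous (fun y => (y - x) 0 i).
Proof.
move=> y; rewrite (_ : (fun y => _) = (fun z : 'rV[R]_n => z 0 i) \- cst (x 0 i)).
  by apply: continuousB; [exact: coord_continuous|exact: cst_continuous].
by apply/funext => z; rewrite !mxE.
Qed.

Lemma quartic_test_C2 U : C2_on U quartic_test.
Proof.
move=> y i k _; rewrite !pderiv_test; split.
- by have [] := is_derive_test y i.
- rewrite (_ : D i = cst (b 0 i) \+ (cst 2 \* (dot (row i A) \o (fun z => z - x)))
     \+ (cst (4 * C) \* ((fun z => (z - x) 0 i) \* ((fun z => (z - x) 0 i) \* (fun z => (z - x) 0 i))))).
    apply: continuousD; [apply: continuousD; [exact: cst_continuous|]|].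
      apply: continuousM; first exact: cst_continuous.
      apply: continuous_comp; last exact: dot_continuous.
      by apply: continuousB; [exact: cvg_id|exact: cst_continuous].
    apply: continuousM; first exact: cst_continuous.
    by do 2?[apply: continuousM]; exact: coord_sub_continuous.
  apply/funext => z; rewrite /D/= 2!exprS expr1.
  by rewrite rowE (dotC _ (z - x)) dot_mxr symA dot_delta.
- by have [] := is_derive2_test y i k.
- rewrite (_ : pderiv k (D i) = cst (2 * A i k) \+
     (cst ((k == i)%:R * (12 * C)) \* ((fun z => (z - x) 0 i) \* (fun z => (z - x) 0 i)))).
    apply: continuousD; first exact: cst_continuous.
    apply: continuousM; first exact: cst_continuous.
    by apply: continuousM; exact: coord_sub_continuous.
  apply/funext => z; rewrite /pderiv; have [_ ->] := is_derive2_test z i k.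
  by rewrite /= mulrA expr2.
Qed.

Lemma hessian_quartic_test : hessian quartic_test x = 2 *: A.
Proof.
apply/matrixP => i k; rewrite !mxE pderiv_test /pderiv.
have [_ ->] := is_derive2_test x i k.
by rewrite subrr mxE expr0n/= !mulr0 addr0.
Qed.

End TestFunction.
End Calculus.

(** * Affine supports of concave functions *)

Section Sublinear.
Variables (R : realType) (n : nat).
Implicit Types (p q : 'rV[R]_n -> R) (e h k : 'rV[R]_n).

Definition sublinear p :=
  (forall (a : R) h, 0 <= a -> p (a *: h) = a * p h) /\
  (forall h k, p (h + k) <= p h + p k).

Lemma sublinear0 p : sublinear p -> p 0 = 0.
Proof. by move=> [ph _]; have := ph 0 0 (lexx _); rewrite scale0r mul0r. Qed.

(** One Hahn-Banach step: taking the infimum of [p (h + t *: e) - t * p e] over [t >= 0] lowers [p]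
    just enough to make it odd at [e]. *)
Lemma sublinear_dominated p e : sublinear p ->
  exists q, [/\ sublinear q, forall h, q h <= p h & q (- e) = - q e].
Proof.
move=> sp; have p0 := sublinear0 sp; have [ph pD] := sp.
pose A h := [set p (h + t *: e) - t * p e | t in [set t : R | 0 <= t]].
pose q h := inf (A h).
have A0 h : A h !=set0 by exists (p (h + 0 *: e) - 0 * p e), 0 => /=.
have lbA h : lbound (A h) (- p (- h)).
  move=> _ [t /= t0 <-]; rewrite lerNl opprB lerBlDr.
  by rewrite -ph//; apply: le_trans (pD _ _); rewrite addKr.
have hA h : has_lbound (A h) by exists (- p (- h)).
have qle h (t : R) : 0 <= t -> q h <= p (h + t *: e) - t * p e.
  by move=> t0; apply: ge_inf => //; exists t.
have leq h c : (forall t : R, 0 <= t -> c <= p (h + t *: e) - t * p e) -> c <= q h.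
  by move=> cA; apply: lb_le_inf => // _ [t /= t0 <-]; exact: cA.
have qp h : q h <= p h by have := qle h 0 (lexx _); rewrite scale0r mul0r addr0 subr0.
have qZ_le (a : R) h : 0 < a -> q (a *: h) <= a * q h.
  move=> a0; rewrite -ler_pdivrMl//; apply: leq => t t0.
  rewrite ler_pdivrMl// mulrBr -(ph a (h + t *: e)) ?(ltW a0)// scalerDr scalerA mulrA.
  by apply: qle; rewrite mulr_ge0// ltW.
have q0 : q 0 = 0.
  apply/eqP; rewrite eq_le; apply/andP; split.
    by apply: le_trans (qp 0) _; rewrite p0.
  by apply: leq => t t0; rewrite add0r ph// subrr.
have qZ (a : R) h : 0 <= a -> q (a *: h) = a * q h.
  rewrite le_eqVlt => /predU1P[<-|a0]; first by rewrite scale0r mul0r.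
  apply/eqP; rewrite eq_le qZ_le//= -ler_pdivlMl//.
  by apply: le_trans (qZ_le _ _ _); rewrite ?invr_gt0// scalerA mulVf ?scale1r// gt_eqF.
have qD h k : q (h + k) <= q h + q k.
  rewrite -lerBlDr; apply: (leq h) => t t0; rewrite lerBlDr -lerBlDl; apply: (leq k) => s s0.
  rewrite lerBlDr; apply: le_trans (qle _ (s + t) (addr_ge0 s0 t0)) _.
  have -> : h + k + (s + t) *: e = (k + s *: e) + (h + t *: e).
    by apply/rowP => i; rewrite !mxE; ring.
  apply: le_trans (lerB (pD (k + s *: e) (h + t *: e)) (lexx _)) _.
  by rewrite le_eqVlt; apply/orP; left; apply/eqP; ring.
exists q; split=> //.
(* Time [t = 1] in the infimum at [- e] gives [q (- e) <= - p e <= - q e]; subadditivity gives the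
   converse. *)
have := qD (- e) e; rewrite addNr q0 => h1; have h2 := qp e.
have := qle (- e) 1 ler01; rewrite scale1r addNr p0 => h3.
by apply/eqP; rewrite eq_le; apply/andP; split; lra.
Qed.

(** The step is repeated over the basis vectors; oddness already obtained survives because [q'] lies
    below [q] while subadditivity bounds [q' h + q' (- h)] below by 0. Once all basis vectors are
    treated, subadditivity at [- h] gives the linear lower bound. *)
Lemma sublinear_ge_linear p : sublinear p -> exists b, forall h, dot b h <= p h.
Proof.
move=> sp.
have [q [sq qp qN]] : exists q, [/\ sublinear q, forall h, q h <= p h &
    forall i : 'I_n, (i < n)%N -> q (- delta_mx 0 i) = - q (delta_mx 0 i)].
  suff gen m : exists q, [/\ sublinear q, forall h, q h <= p h &
    forall i : 'I_n, (i < m)%N -> q (- delta_mx 0 i) = - q (delta_mx 0 i)] by exact: gen.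
  elim: m => [|m [q [sq qp qN]]]; first by exists p.
  have [mn|nm] := ltnP m n; last first.
    by exists q; split=> // i _; apply: qN; apply: leq_trans nm.
  have [q' [sq' q'q q'e]] := sublinear_dominated (delta_mx 0 (Ordinal mn)) sq.
  exists q'; split=> // [h|i]; first exact: le_trans (q'q h) (qp h).
  rewrite ltnS leq_eqVlt => /predU1P[im|/qN qi].
    by rewrite (_ : i = Ordinal mn)//; apply/val_inj.
  apply/eqP; rewrite -addr_eq0 eq_le; apply/andP; split.
    by apply: le_trans (lerD (q'q _) (q'q _)) _; rewrite qi addNr.
  by rewrite -{1}(sublinear0 sq') -(addNr (delta_mx 0 i)); apply: sq'.2.
exists (\row_i q (delta_mx 0 i)) => h; apply: le_trans (qp h).
have qZ (a : R) (i : 'I_n) : q (a *: delta_mx 0 i) = a * q (delta_mx 0 i).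
  have [a0|a0] := leP 0 a; first exact: sq.1.
  rewrite -[a *: _]opprK -scalerN -scaleNr sq.1 ?oppr_ge0 ?ltW//.
  by rewrite qN ?ltn_ord// mulrNN.
have qs u : q u <= \sum_i u 0 i * q (delta_mx 0 i).
  rewrite {1}(row_sum_delta u).
  elim/big_ind2 : _ => [|x a y c xa yc|i _]; first by rewrite sublinear0.
    by apply: le_trans (sq.2 _ _) _; exact: lerD.
  by rewrite qZ.
apply: le_trans (_ : - q (- h) <= _).
  rewrite lerNr; apply: le_trans (qs _) _; rewrite dotE -sumrN ler_sum// => i _.
  by rewrite !mxE mulNr mulrC.
by rewrite lerNl -subr_ge0 opprK -(sublinear0 sq) -(addNr h); exact: sq.2.
Qed.

End Sublinear.

(** * Supporting affine functions and exit times *)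

Section Convex.
Variables (R : realType) (n : nat).
Implicit Types (x y h : 'rV[R]_n) (A C K : set 'rV[R]_n) (f : 'rV[R]_n -> R).

Lemma convex_setE A : @convex_set R 'rV[R]_n A <->
  forall x y (t : R), A x -> A y -> 0 <= t -> t <= 1 -> A (t *: x + (1 - t) *: y).
Proof.
split=> [cA x y t Ax Ay t0 t1|cA x y t].
  by have := cA x y (Itv01 t0 t1) (mem_set Ax) (mem_set Ay); rewrite inE.
by rewrite !inE => Ax Ay; apply: cA.
Qed.

Lemma concave_onE K f : concave_on K f <->
  forall x y (t : R), K x -> K y -> 0 <= t -> t <= 1 ->
    t * f x + (1 - t) * f y <= f (t *: x + (1 - t) *: y).
Proof.
split=> [cf x y t Kx Ky t0 t1|cf t x y].
  have := cf (Itv01 t0 t1) x y (mem_set Kx) (mem_set Ky).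
  by rewrite convRE/= !mulrN -opprD lerN2.
rewrite !inE => Kx Ky; rewrite convRE !mulrN -opprD lerN2; exact: cf.
Qed.

Lemma sub_convex_hull A : A `<=` convex_hull A.
Proof. by move=> x Ax C _; apply. Qed.

Lemma convex_hull_sub A C : @convex_set R 'rV[R]_n C -> A `<=` C -> convex_hull A `<=` C.
Proof. by move=> cC AC x; apply. Qed.

Lemma convex_hullP A : @convex_set R 'rV[R]_n (convex_hull A).
Proof.
apply/convex_setE => x y t hx hy t0 t1 C cC AC.
by move/convex_setE : (cC); apply => //; [exact: hx|exact: hy].
Qed.

Lemma concave_onS A K f : A `<=` K -> concave_on K f -> concave_on A f.
Proof. by move=> AK /concave_onE cf; apply/concave_onE => x y t /AK Kx /AK Ky; exact: cf. Qed.

Lemma convex_set_ball x (r : R) : @convex_set R 'rV[R]_n (ball x r).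
Proof.
apply/convex_setE => y z t; rewrite -ball_normE/= => xy xz t0 t1.
have -> : x - (t *: y + (1 - t) *: z) = t *: (x - y) + (1 - t) *: (x - z).
  by apply/rowP => i; rewrite !mxE; ring.
apply: le_lt_trans (ler_normD _ _) _; rewrite !normrZ ger0_norm// ger0_norm ?subr_ge0//.
have [->|tn0] := eqVneq t 0; first by rewrite mul0r add0r subr0 mul1r.
have tp : 0 < t by rewrite lt_def tn0.
have -> : r = t * r + (1 - t) * r by ring.
by apply: ltr_leD; [rewrite ltr_pM2l|rewrite ler_wpM2l ?subr_ge0// ltW].
Qed.

(** The one-sided directional derivative of [- f] at [x] is sublinear, and a linear form below it
    gives the support. It is taken as an infimum of difference quotients, so that no limit or
    monotonicity is involved. *)
Lemma concave_support K f x (r : R) : 0 < r -> ball x r `<=` K ->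
  @convex_set R 'rV[R]_n K -> concave_on K f ->
  exists b, forall y, K y -> f y <= f x + dot b (y - x).
Proof.
move=> r0 rK /convex_setE cK /concave_onE cf.
pose Q h (t : R) := (f x - f (x + t *: h)) / t.
pose A h := [set Q h t | t in [set t : R | 0 < t /\ K (x + t *: h)]].
pose p h := inf (A h).
have small h : exists2 t : R, 0 < t & K (x + t *: h).
  have h0 : 0 < `|h| + 1 by rewrite ltr_wpDl.
  exists (r / (`|h| + 1)); first by rewrite divr_gt0.
  apply: rK; rewrite -ball_normE/= opprD addrA subrr add0r normrN normrZ.
  rewrite ger0_norm ?divr_ge0 ?ltW// mulrAC ltr_pdivrMr// ltr_pM2l//.
  by rewrite ltrDl.
have A0 h : A h !=set0 by have [t t0 Kt] := small h; exists (Q h t), t.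
(* With [u = t * s / (t + s)] the point [x + u *: (h + k)] is a convex combination of [x + t *: h]
   and [x + s *: k]. This yields subadditivity and, for [k = - h], the lower bound of the
   quotients. *)
have key h k (t s : R) : 0 < t -> 0 < s -> K (x + t *: h) -> K (x + s *: k) ->
  exists2 u : R, 0 < u & K (x + u *: (h + k)) /\ Q (h + k) u <= Q h t + Q k s.
  move=> t0 s0 Kt Ks; have ts0 : 0 < t + s by rewrite addr_gt0.
  pose a := s / (t + s); have a0 : 0 <= a by rewrite divr_ge0 ?ltW.
  have a1 : a <= 1 by rewrite ler_pdivrMr// mul1r lerDr ltW.
  exists (t * s / (t + s)); first by rewrite divr_gt0// mulr_gt0.
  have E : x + (t * s / (t + s)) *: (h + k) = a *: (x + t *: h) + (1 - a) *: (x + s *: k).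
    by apply/rowP => i; rewrite !mxE /a; field; rewrite gt_eqF.
  rewrite E; split; first exact: cK.
  rewrite /Q E; have := cf _ _ a Kt Ks a0 a1.
  set f1 := f (x + t *: h); set f2 := f (x + s *: k) => le.
  apply: (@le_trans _ _ ((f x - (a * f1 + (1 - a) * f2)) / (t * s / (t + s)))).
    by rewrite ler_pM2r ?lerB// invr_gt0 divr_gt0// mulr_gt0.
  rewrite le_eqVlt; apply/orP; left; apply/eqP; rewrite /a; field.
  by rewrite !gt_eqF.
have hA h : has_lbound (A h).
  have [s s0 Ks] := small (- h); exists (- Q (- h) s) => _ [t /= [t0 Kt] <-].
  have [u u0 [Ku]] := key _ _ _ _ t0 s0 Kt Ks.
  rewrite subrr {1}/Q scaler0 addr0 subrr mul0r => ?; lra.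
have ple h (t : R) : 0 < t -> K (x + t *: h) -> p h <= Q h t.
  by move=> t0 Kt; apply: ge_inf => //; exists t.
have lep h c : (forall t : R, 0 < t -> K (x + t *: h) -> c <= Q h t) -> c <= p h.
  by move=> cA; apply: lb_le_inf => // _ [t /= [t0 Kt] <-]; exact: cA.
have p0 : p 0 = 0.
  have [t t0 Kt] := small 0.
  apply/eqP; rewrite eq_le; apply/andP; split.
    by have := ple _ _ t0 Kt; rewrite /Q scaler0 addr0 subrr mul0r.
  by apply: lep => s s0 _; rewrite /Q scaler0 addr0 subrr mul0r.
have pZ_le (a : R) h : 0 < a -> p (a *: h) <= a * p h.
  move=> a0; rewrite -ler_pdivrMl//; apply: lep => t t0 Kt.
  have ta0 : 0 < t / a by rewrite divr_gt0.
  have E : (t / a) *: (a *: h) = t *: h by rewrite scalerA divfK ?gt_eqF.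
  rewrite ler_pdivrMl//; have := @ple (a *: h) (t / a) ta0; rewrite E => /(_ Kt).
  move/le_trans; apply; rewrite /Q E le_eqVlt; apply/orP; left; apply/eqP.
  by field; rewrite !gt_eqF.
have sp : sublinear p.
  split=> [a h|h k].
    rewrite le_eqVlt => /predU1P[<-|a0]; first by rewrite scale0r mul0r.
    apply/eqP; rewrite eq_le pZ_le//= -ler_pdivlMl//.
    by apply: le_trans (pZ_le _ _ _); rewrite ?invr_gt0// scalerA mulVf ?scale1r// gt_eqF.
  rewrite -lerBlDr; apply: (lep h) => t t0 Kt; rewrite lerBlDr -lerBlDl; apply: lep => s s0 Ks.
  have [u u0 [Ku le]] := key _ _ _ _ t0 s0 Kt Ks.
  by have := ple _ _ u0 Ku; lra.
have [b bp] := sublinear_ge_linear sp.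
exists (- b) => y Ky; have Ky1 : K (x + 1 *: (y - x)) by rewrite scale1r addrC subrK.
have := le_trans (bp (y - x)) (ple _ _ ltr01 Ky1).
by rewrite /Q scale1r divr1 (addrC x) subrK dotNl => le; lra.
Qed.

(** The infimum of the times spent outside [O]: such times exist by boundedness, and the infimum is
    one of them because the complement is closed. *)
Lemma exit_time (O : set 'rV[R]_n) x h : open O -> bounded_set O -> O x -> h != 0 ->
  exists2 t : R, 0 < t & ~ O (x + t *: h) /\ forall s, 0 <= s -> s < t -> O (x + s *: h).
Proof.
move=> oO bO Ox h0; have hp : 0 < `|h| by rewrite normr_gt0.
pose T := [set t : R | 0 <= t /\ ~ O (x + t *: h)].
have T0 : T !=set0.
  have /ex_strict_bound_gt0[M M0 OM] := bO.
  exists ((M + `|x|) / `|h|); split=> [|/OM /=].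
    by rewrite divr_ge0// addr_ge0// ltW.
  apply/negP; rewrite -leNgt addrC -[x in _ + x]opprK.
  apply: le_trans (lerB_dist _ _); rewrite normrN normrZ ger0_norm; last first.
    by rewrite divr_ge0// addr_ge0// ltW.
  by rewrite divfK ?gt_eqF// addrK.
have lT : has_lbound T by exists 0 => t [].
pose t := inf T.
have t0 : 0 <= t by apply: lb_le_inf => // s [].
have below s : 0 <= s -> s < t -> O (x + s *: h).
  move=> s0 st; apply: contrapT => nO; move: st; apply/negP; rewrite -leNgt.
  by apply: ge_inf.
have nOt : ~ O (x + t *: h).
  move=> Ot; have /nbhs_ballP[r r0 rO] : nbhs (x + t *: h) O by exact: open_nbhs_nbhs.
  have [s [s0 nOs] st] : exists2 s, T s & s < t + r / `|h|.
    by apply: inf_adherent => //; rewrite divr_gt0.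
  have ts : t <= s by apply: ge_inf.
  apply: nOs; apply: rO; rewrite -ball_normE/= opprD addrACA subrr add0r -scalerBl.
  by rewrite normrZ distrC ger0_norm ?subr_ge0// -ltr_pdivlMr// ltrBlDl.
exists t; last by split.
by rewrite lt_def t0 andbT; apply/eqP => t00; apply: nOt; rewrite t00 scale0r addr0.
Qed.

End Convex.

(** * Affine subspaces and their relative domains *)

Section AffineSubspace.
Variables (R : realType) (n : nat).
Implicit Types (x y h p : 'rV[R]_n) (V : {vspace 'rV[R]_n}).

Definition translate V p : set 'rV[R]_n := [set x | x - p \in V].

Lemma translateD V p x h : h \in V -> translate V p x -> translate V p (x + h).
Proof. by move=> hV; rewrite /translate/= addrAC => xV; exact: memvD. Qed.

Lemma translate_refl V p : translate V p p.
Proof. by rewrite /translate/= subrr mem0v. Qed.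

Lemma translateB V p x y : translate V p x -> translate V p y -> x - y \in V.
Proof.
rewrite /translate/= => xV yV.
have -> : x - y = (x - p) - (y - p) by rewrite opprB addrA subrK.
exact: memvB.
Qed.

Lemma translate_convex V p : @convex_set R 'rV[R]_n (translate V p).
Proof.
apply/convex_setE => x y t xV yV t0 t1; rewrite /translate/=.
have -> : t *: x + (1 - t) *: y - p = t *: (x - p) + (1 - t) *: (y - p).
  by rewrite !scalerBr addrACA -opprD -scalerDl (addrC t) subrK scale1r.
by rewrite memvD// memvZ.
Qed.

Lemma mulmx_norm_le x (M : 'M[R]_n) : `|x *m M| <= n%:R * `|M| * `|x|.
Proof.
apply: norm_leP => [|k]; first by rewrite !mulr_ge0.
rewrite mxE; apply: le_trans (ler_norm_sum _ _ _) _.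
apply: (@le_trans _ _ (\sum_(i < n) `|M| * `|x|)).
  apply: ler_sum => i _; rewrite normrM mulrC ler_pM ?coord_norm_le//.
  rewrite [leRHS]/Num.Def.normr /= mx_normrE; apply/bigmax_geP; right => /=.
  by exists (i, k).
by rewrite sumr_const card_ord -[leLHS]mulr_natl mulrA.
Qed.

Lemma mulmxr_continuous (M : 'M[R]_n) : continuous (fun x : 'rV[R]_n => x *m M).
Proof.
move=> x; apply/(@cvgrPdist_lt _ _ _ (nbhs x) (nbhs_filter x)) => e e0.
have c0 : 0 < n%:R * `|M| + 1 :> R by rewrite ltr_wpDl// mulr_ge0.
near=> y; rewrite -mulmxBl; apply: le_lt_trans (mulmx_norm_le _ _) _.
apply: (@le_lt_trans _ _ ((n%:R * `|M| + 1) * `|x - y|)).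
  by rewrite ler_wpM2r// lerDl.
rewrite -ltr_pdivlMl// mulrC; near: y.
by apply: cvgr_dist_lt; rewrite ?divr_gt0//; exact: cvg_id.
Unshelve. all: by end_near. Qed.

Lemma affine_projection_continuous p (M : 'M[R]_n) :
  continuous (fun x : 'rV[R]_n => p + (x - p) *m M).
Proof.
move=> x; apply: (@continuousD _ _ _ (cst p) (fun z : 'rV[R]_n => (z - p) *m M)).
  exact: cst_continuous.
apply: (@continuous_comp _ _ _ (fun z : 'rV[R]_n => z - p) (fun z : 'rV[R]_n => z *m M)).
  by apply: continuousB; [exact: cvg_id|exact: cst_continuous].
exact: mulmxr_continuous.
Qed.

Lemma vspace_projection V : exists M : 'M[R]_n,
  (forall h, h *m M \in V) /\ (forall h, h \in V -> h *m M = h).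
Proof.
exists (lin1_mx (projv V)); split=> h; first by rewrite mul_rV_lin1 memv_proj.
by move=> hV; rewrite mul_rV_lin1; exact: projv_id.
Qed.

Lemma translate_closed V p : closed (translate V p).
Proof.
have [M [MV Mid]] := vspace_projection V.
have -> : translate V p = (fun x => (x - p) *m (1%:M - M)) @^-1` [set 0].
  apply/seteqP; split=> x; rewrite /translate/= mulmxBr mulmx1.
    by move=> xV; rewrite Mid// subrr.
  by move/eqP; rewrite subr_eq0 => /eqP ->.
apply: preimage_closed; last first.
  exact/accessible_closed_set1/hausdorff_accessible/norm_hausdorff.
move=> x _; apply: (@continuous_comp _ _ _ (fun x : 'rV[R]_n => x - p)
  (fun x : 'rV[R]_n => x *m (1%:M - M))); last exact: mulmxr_continuous.
by apply: continuousB; [exact: cvg_id|exact: cst_continuous].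
Qed.

Lemma exit_boundary V p (O : set 'rV[R]_n) x h :
  open O -> bounded_set O -> translate V p x -> O x -> h \in V -> h != 0 ->
  exists2 t : R, 0 < t & [/\ translate V p (x + t *: h), ~ O (x + t *: h) &
    closure (translate V p `&` O) (x + t *: h)].
Proof.
move=> oO bO Sx Ox hV h0; have hp : 0 < `|h| by rewrite normr_gt0.
have [t t0 [nO bel]] := exit_time oO bO Ox h0.
exists t => //; split=> //; first by apply: translateD; rewrite ?memvZ.
move=> B /nbhs_ballP[r r0 rB].
have m0 : 0 < Num.min t (r / `|h|) by rewrite lt_min t0 divr_gt0.
pose d := Num.min t (r / `|h|) / 2.
have d0 : 0 < d by rewrite divr_gt0.
have /andP[dt dr] : (d < t) && (d < r / `|h|) by rewrite -lt_min /d; lra.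
exists (x + (t - d) *: h); split; last first.
  apply: rB; rewrite -ball_normE/= opprD addrACA subrr add0r -scalerBl.
  by rewrite opprB addrC subrK normrZ ger0_norm ?ltW// -ltr_pdivlMr.
split; first by apply: translateD; rewrite ?memvZ.
by apply: bel; rewrite ?subr_ge0 ?ltW// ltrBlDr ltrDl.
Qed.

End AffineSubspace.

(** * Comparison along a line and connectedness of discs *)

Section RelativeDomains.
Variables (R : realType) (n : nat).
Implicit Types (x y h p : 'rV[R]_n) (V : {vspace 'rV[R]_n}) (O U K : set 'rV[R]_n).
Implicit Types (f q : 'rV[R]_n -> R).

Lemma boundary_translate V p U y : translate V p y -> ~ U y ->
  closure (translate V p `&` U) y ->
  boundary_in (translate V p) (translate V p `&` U) y.
Proof.
move=> Sy nU cy; split=> //; apply: subset_closure; split=> // -[] _.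
exact: nU.
Qed.

Lemma boundary_translate_out V p U y : open U ->
  boundary_in (translate V p) (translate V p `&` U) y -> ~ U y.
Proof.
move=> oU [_ cy] Uy; have [z [[Sz nD] Uz]] := cy _ (open_nbhs_nbhs (conj oU Uy)).
exact: nD.
Qed.

Lemma hull_closure_translate V p U :
  convex_hull (closure (translate V p `&` U)) `<=` translate V p.
Proof.
apply: convex_hull_sub; first exact: translate_convex.
rewrite [X in _ `<=` X](closure_id _).1; last exact: translate_closed.
by apply: closure_subset => y [].
Qed.

(** Following the line through [x] in both directions until it leaves [O] puts [x] between two
    points where [q <= f]; [q] is convex on that line and [f] is concave. *)
Lemma line_comparison V p O x h K f q :
  open O -> bounded_set O -> translate V p x -> O x -> h \in V -> h != 0 ->
  concave_on K f ->
  (forall y, translate V p y -> ~ O y -> closure (translate V p `&` O) y ->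
     K y /\ q y <= f y) ->
  (forall y z (s t : R), y - z = s *: h -> 0 <= t -> t <= 1 ->
     q (t *: y + (1 - t) *: z) <= t * q y + (1 - t) * q z) ->
  q x <= f x.
Proof.
move=> oO bO Sx Ox hV h0 /concave_onE cf qf qc.
have [t1 t10 [S1 O1 C1]] := exit_boundary oO bO Sx Ox hV h0.
have [t2 t20 [S2 O2 C2]] : exists2 t : R, 0 < t &
    [/\ translate V p (x + t *: - h), ~ O (x + t *: - h) &
    closure (translate V p `&` O) (x + t *: - h)].
  by apply: exit_boundary; rewrite ?memvN ?oppr_eq0.
have [K1 q1] := qf _ S1 O1 C1; have [K2 q2] := qf _ S2 O2 C2.
have tt0 : 0 < t1 + t2 by rewrite addr_gt0.
(* The barycentric weight of the first exit point in [x]. *)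
pose a := t2 / (t1 + t2); have a0 : 0 <= a by rewrite divr_ge0 ?ltW.
have a1 : a <= 1 by rewrite ler_pdivrMr// mul1r lerDr ltW.
set y1 := x + t1 *: h in S1 O1 C1 K1 q1; set y2 := x + t2 *: - h in S2 O2 C2 K2 q2.
have xE : x = a *: y1 + (1 - a) *: y2.
  by apply/rowP => i; rewrite !mxE /a; field; rewrite gt_eqF.
have y12 : y1 - y2 = (t1 + t2) *: h by apply/rowP => i; rewrite !mxE; ring.
rewrite xE; apply: le_trans (qc _ _ _ _ y12 a0 a1) _.
apply: le_trans (cf _ _ _ K1 K2 a0 a1).
by rewrite lerD// ler_wpM2l// subr_ge0.
Qed.

Lemma line_comparison_cst V p O x K f (c : R) : (0 < \dim V)%N ->
  open O -> bounded_set O -> translate V p x -> O x -> concave_on K f ->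
  (forall y, translate V p y -> ~ O y -> closure (translate V p `&` O) y ->
     K y /\ c <= f y) ->
  c <= f x.
Proof.
move=> V0 oO bO Sx Ox cf qf.
apply: (@line_comparison V p O x (vpick V) K f (fun=> c)) => //.
- exact: memv_pick.
- by rewrite vpick0 -dimv_eq0 -lt0n.
- by move=> *; rewrite -mulrDl addrC subrK mul1r.
Qed.

Lemma convex_connected K : @convex_set R 'rV[R]_n K -> connected K.
Proof.
move=> /convex_setE cK; have [[x Kx]|K0] := pselect (K !=set0); last first.
  suff -> : K = set0 by exact: connected0.
  by apply/seteqP; split=> // y Ky; apply: K0; exists y.
pose seg y : set 'rV[R]_n := (fun t : R => t *: y + (1 - t) *: x) @` `[0, 1].
have -> : K = \bigcup_(y in K) seg y.
  apply/seteqP; split=> [y Ky|y [z Kz [t]]].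
    exists y => //; exists 1; first by rewrite /= in_itv/= ler01 lexx.
    by rewrite scale1r subrr scale0r addr0.
  by rewrite /= in_itv/= => /andP[t0 t1] <-; exact: cK.
apply: bigcup_connected => [|y Ky].
  exists x => y Ky; exists 0; first by rewrite /= in_itv/= ler01 lexx.
  by rewrite scale0r add0r subr0 scale1r.
apply: connected_continuous_connected; last first.
  apply: continuous_subspaceT => t.
  apply: (@continuousD _ _ _ (fun t : R => t *: y) (fun t : R => (1 - t) *: x)).
    exact: scalel_continuous.
  apply: (@continuous_comp _ _ _ (fun t : R => 1 - t) (fun t : R => t *: x)).
    by apply: continuousB; [exact: cst_continuous|exact: cvg_id].
  exact: scalel_continuous.
by apply/connected_intervalP; exact: interval_is_interval.
Qed.

Lemma domain_in_translate_ball V p (r : R) : 0 < r ->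
  domain_in (translate V p) (translate V p `&` ball p r).
Proof.
move=> r0; split.
- by exists (ball p r) => //; exact: ball_open.
- apply: convex_connected; apply/convex_setE => x y t [Sx Bx] [Sy By] t0 t1.
  split; [move/convex_setE: (@translate_convex R n V p)|
          move/convex_setE: (@convex_set_ball R n p r)]; exact.
- by exists p; split; [exact: translate_refl|exact: ballxx].
Qed.

Lemma sub_bounded_set K U : K `<=` U -> bounded_set U -> bounded_set K.
Proof. by move=> KU [M [Mr MU]]; exists M; split=> // M' MM' x /KU; exact: MU. Qed.

Lemma closure_bounded K : bounded_set K -> bounded_set (closure K).
Proof.
move=> /ex_strict_bound_gt0[M M0 KM]; exists M; split; first exact: num_real.
move=> M' MM' x cKx; apply: le_trans (ltW MM').
have cl : closed [set y : 'rV[R]_n | `|y| <= M].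
  apply: (@preimage_closed _ _ (fun y : 'rV[R]_n => `|y|) [set t | t <= M]).
    by move=> y _; exact: norm_continuous.
  exact: closed_le.
have : closure [set y : 'rV[R]_n | `|y| <= M] x.
  by apply: closure_subset cKx => y /KM /= /ltW.
by rewrite -(closure_id _).1.
Qed.

End RelativeDomains.

(** * The class H_j and its supremum *)

Section PerronClass.
Variables (R : realType) (N j : nat) (Omega : set 'rV[R]_N) (g : 'rV[R]_N -> R).
Hypotheses (hj : (1 <= j <= N)%N) (oOmega : open Omega) (hbnd : bounded_set Omega).
Hypothesis (hg : {within boundary_in setT Omega, continuous g}).
Implicit Types (x y h p : 'rV[R]_N) (V : {vspace 'rV[R]_N}) (D U : set 'rV[R]_N).
Implicit Types (v f : 'rV[R]_N -> R).

Lemma H_classP v : H_class j Omega g v <->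
  (forall x, boundary_in setT Omega x -> v x <= g x) /\
  forall V p U f x, \dim V = j -> open U ->
    let D := translate V p `&` U in
    domain_in (translate V p) D -> D `<=` Omega ->
    concave_on (convex_hull (closure D)) f ->
    (forall y, boundary_in (translate V p) D y -> v y <= f y) -> D x -> v x <= f x.
Proof.
split=> [[vg vH]|[vg vH]]; split=> //.
  move=> V p U f x dV oU D dD DO cf vf Dx.
  have /(_ _ Dx) : forall x, D x -> ((v x)%:E <= concave_envelope (translate V p) D v x)%E.
    by apply: vH => //; exists p, V.
  move=> /le_trans /(_ (ereal_inf_lbound _)) => /(_ (f x)%:E).
  by rewrite lee_fin; apply; exists f.
move=> S D [p [V [dV SE]]] dD DO x Dx; subst S.
have [[U oU DE] _ _] := dD; subst D.
apply: le_ereal_inf_tmp => _ [f [cf vf] <-]; rewrite lee_fin.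
exact: (vH V p U).
Qed.

Lemma boundaryP x : boundary_in setT Omega x <-> closure Omega x /\ ~ Omega x.
Proof.
split=> [[[_ cx] dx]|[cx nx]].
  split=> // Ox; have [y [[_ nO] Oy]] := dx _ (open_nbhs_nbhs (conj oOmega Ox)).
  exact: nO.
by split; [split|apply: subset_closure].
Qed.

Lemma closure_cases x : closure Omega x -> Omega x \/ boundary_in setT Omega x.
Proof. by move=> cx; have [Ox|nx] := pselect (Omega x); [left|right; apply/boundaryP]. Qed.

Lemma boundary_bound : exists M : R, forall x, boundary_in setT Omega x -> `|g x| <= M.
Proof.
have cB : closed (boundary_in setT Omega).
  rewrite /boundary_in setTI; apply: closedI; exact: closed_closure.
have bB : bounded_set (boundary_in setT Omega).
  by apply: sub_bounded_set (closure_bounded hbnd) => x [[_]].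
have /compact_bounded/ex_strict_bound_gt0[M M0 gM] :
    compact (g @` boundary_in setT Omega).
  exact/continuous_compact/bounded_closed_compact.
by exists M => x Bx; apply: ltW; apply: gM; exists x.
Qed.

Lemma exists_dim : exists V, \dim V = j.
Proof.
have [|V [dV _]] := @lambda_min_max R N j 0 hj; first by rewrite trmx0.
by exists V.
Qed.

Lemma sub_closure V p U y : translate V p `&` U `<=` Omega ->
  boundary_in (translate V p) (translate V p `&` U) y -> closure Omega y.
Proof. by move=> DO [[_ cy] _]; exact: closure_subset cy. Qed.

(** The open set [U] that cuts out D may be unbounded, so exit times are taken from its intersection
    with Omega, which has the same trace on the plane. The exit point is then a relative boundary
    point of D. *)
Lemma boundary_restrict V p U y : translate V p `&` U `<=` Omega -> 
  translate V p y -> ~ (U `&` Omega) y -> closure (translate V p `&` (U `&` Omega)) y ->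
  boundary_in (translate V p) (translate V p `&` U) y.
Proof.
move=> DO Sy nU; rewrite setIA [X in closure X]setIidl// => cy.
split=> //; apply: subset_closure; split=> // -[_ Uy].
by apply: nU; split=> //; exact: DO.
Qed.

(** Gives nonemptiness of the class and the lower bound of u. As [j] is positive, the plane contains
    a line through the point, and a concave [f] that is at least [c] at its two exit points is at
    least [c] between them. *)
Lemma H_class_cst (c : R) : (forall x, boundary_in setT Omega x -> c <= g x) ->
  H_class j Omega g (fun=> c).
Proof.
move=> cg; apply/H_classP; split=> // V p U f x dV oU D dD DO cf vf [Sx Ux].
apply: (@line_comparison_cst R N V p (U `&` Omega) x _ f c _ _ _ Sx _ cf).
- by rewrite dV; case/andP: hj.
- exact: openI.
- by apply: sub_bounded_set hbnd => y [].
- by split=> //; apply: DO.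
move=> y Sy nU cy; have By := boundary_restrict DO Sy nU cy.
by split; [apply: sub_convex_hull; case: By => -[]|exact: vf].
Qed.

Lemma component_domain V p : Omega p ->
  let D := connected_component (translate V p `&` Omega) p in
  exists U, [/\ open U, D = translate V p `&` U, domain_in (translate V p) D, D p &
    D `<=` Omega /\ forall y, boundary_in (translate V p) D y -> ~ Omega y].
Proof.
move=> Op D; set S := translate V p in D *.
have SOp : (S `&` Omega) p by split=> //; exact: translate_refl.
have Dp : D p by exact: connected_component_refl.
have DSO : D `<=` S `&` Omega by exact: connected_component_sub.
have cB y (r : R) : connected (S `&` ball y r).
  apply: convex_connected; apply/convex_setE => a b t [Sa Ba] [Sb Bb] t0 t1.
  split; [move/convex_setE: (@translate_convex R N V p)|
          move/convex_setE: (@convex_set_ball R N y r)]; exact.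
have absorb y (r : R) z : ball y r `<=` Omega -> (S `&` ball y r) z -> D z ->
    S `&` ball y r `<=` D.
  move=> rO Bz Dz; rewrite /D (same_connected_component Dz).
  by apply: connected_component_max => // a [Sa /rO].
(* The union of all balls whose trace on the plane lies in D: an open set of the full space
   witnessing that D is relatively open. *)
pose U := [set z | exists y (r : R), S `&` ball y r `<=` D /\ ball y r z].
have oU : open U.
  rewrite openE => z [y [r [rD rz]]].
  have : nbhs z (ball y r).
    by apply: open_nbhs_nbhs; split=> //; apply: ball_open; case: rz.
  by apply: filterS => a ra; exists y, r.
have DE : D = S `&` U.
  apply/seteqP; split=> [y Dy|y [Sy [z [r [rD rz]]]]]; last exact: rD.
  have [Sy Oy] := DSO _ Dy; split=> //.
  have /nbhs_ballP[r r0 rO] : nbhs y Omega by exact: open_nbhs_nbhs.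
  exists y, r; split; last exact: ballxx.
  by apply: (absorb y r y) => //; split=> //; exact: ballxx.
exists U; split=> //; last split.
- by split; [exists U|exact: component_connected|exists p].
- by move=> y /DSO[].
move=> y [[Sy cDy] cy] Oy.
have /nbhs_ballP[r r0 rO] : nbhs y Omega by exact: open_nbhs_nbhs.
have [z [Dz rz]] := cDy _ (nbhsx_ballx y r r0).
have Dy : (S `&` ball y r) `<=` D.
  by apply: (absorb y r z) => //; split=> //; case: (DSO _ Dz).
have [a [[Sa nDa] ra]] := cy _ (nbhsx_ballx y r r0).
by apply: nDa; exact: Dy.
Qed.

(** On the component through [x] of a plane section, the constant [M] is a concave majorant of the
    boundary values. *)
Lemma H_class_bounded v (M : R) x : H_class j Omega g v ->
  (forall y, boundary_in setT Omega y -> g y <= M) -> closure Omega x -> v x <= M.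
Proof.
move=> /H_classP[vg vH] gM /closure_cases[Ox|Bx]; last exact: le_trans (vg _ Bx) (gM _ Bx).
have [V dV] := exists_dim.
have [U [oU DE dD Dp [DO Dout]]] := component_domain V Ox.
rewrite DE in dD Dp DO Dout.
apply: (vH V x U (fun=> M) x) => //.
  by apply/concave_onE => *; rewrite -mulrDl addrC subrK mul1r.
move=> y By; have bdy : boundary_in setT Omega y.
  by apply/boundaryP; split; [exact: sub_closure By|exact: Dout].
exact: le_trans (vg _ bdy) (gM _ bdy).
Qed.

Lemma H_values_has_sup x : closure Omega x -> has_sup [set v x | v in H_class j Omega g].
Proof.
move=> cx; have [M gM] := boundary_bound; split.
  exists (- M), (fun=> - M) => //; apply: H_class_cst => y By.
  by have := gM y By; rewrite ler_norml => /andP[].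
exists M => _ [v vH <-]; apply: H_class_bounded vH _ cx => y By.
by have := gM y By; rewrite ler_norml => /andP[].
Qed.

Local Notation u := (sup_H j Omega g).

Lemma le_sup_H v x : H_class j Omega g v -> closure Omega x -> v x <= u x.
Proof. by move=> vH cx; apply: sup_upper_bound; [exact: H_values_has_sup|exists v]. Qed.

Lemma sup_H_le x (c : R) : closure Omega x -> (forall v, H_class j Omega g v -> v x <= c) ->
  u x <= c.
Proof.
move=> cx vc; apply: ge_sup; first by have [] := H_values_has_sup cx.
by move=> _ [v vH <-]; exact: vc.
Qed.

Lemma sup_H_boundary x : boundary_in setT Omega x -> u x <= g x.
Proof.
move=> Bx; have [cx _] := (boundaryP x).1 Bx.
by apply: sup_H_le => // v [vg _]; exact: vg.
Qed.

Lemma sup_H_bounded : exists M : R, forall x, closure Omega x -> `|u x| <= M.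
Proof.
have [M gM] := boundary_bound; exists M => x cx; rewrite ler_norml; apply/andP; split.
  apply: (@le_sup_H (fun=> - M)) => //; apply: H_class_cst => y By.
  by have := gM y By; rewrite ler_norml => /andP[].
apply: sup_H_le => // v vH; apply: H_class_bounded vH _ cx => y By.
by have := gM y By; rewrite ler_norml => /andP[].
Qed.

Lemma sup_H_in_H : H_class j Omega g u.
Proof.
apply/H_classP; split; first exact: sup_H_boundary.
move=> V p U f x dV oU D dD DO cf uf Dx; apply: sup_H_le.
  by apply: subset_closure; exact: DO.
move=> v vH; have /H_classP[_ /(_ V p U f x dV oU dD DO cf)] := vH; apply=> // y By.
by apply: le_trans (uf _ By); apply: le_sup_H => //; exact: sub_closure By.
Qed.

End PerronClass.

(** * The supremum is a viscosity solution *)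

Section Envelopes.
Variables (R : realType) (n : nat) (A : set 'rV[R]_n) (u : 'rV[R]_n -> R).
Implicit Types (x y : 'rV[R]_n).

Lemma le_usc_env x : A x -> ((u x)%:E <= usc_env A u x)%E.
Proof.
move=> Ax; apply: le_ereal_inf_tmp => _ [r /= r0 <-]; apply: ereal_sup_ubound.
by exists x => //; split=> //; exact: ballxx.
Qed.

Lemma lsc_env_le x : A x -> (lsc_env A u x <= (u x)%:E)%E.
Proof.
move=> Ax; apply: ge_ereal_sup => _ [r /= r0 <-]; apply: ereal_inf_lbound.
by exists x => //; split=> //; exact: ballxx.
Qed.

Lemma usc_env_le x (M : R) : (forall y, A y -> u y <= M) -> (usc_env A u x <= M%:E)%E.
Proof.
move=> uM; apply: (@le_trans _ _ (ereal_sup [set (u y)%:E | y in ball x 1 `&` A])).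
  by apply: ereal_inf_lbound; exists 1 => /=.
by apply: ge_ereal_sup => _ [y [_ Ay] <-]; rewrite lee_fin uM.
Qed.

Lemma lsc_env_ge x (M : R) : (forall y, A y -> M <= u y) -> (M%:E <= lsc_env A u x)%E.
Proof.
move=> uM; apply: (@le_trans _ _ (ereal_inf [set (u y)%:E | y in ball x 1 `&` A])).
  by apply: le_ereal_inf_tmp => _ [y [_ Ay] <-]; rewrite lee_fin uM.
by apply: ereal_sup_ubound; exists 1 => /=.
Qed.

Lemma usc_env_approx x (c e r : R) : usc_env A u x = c%:E -> 0 < e -> 0 < r ->
  exists y, [/\ ball x r y, A y & c - e < u y].
Proof.
move=> uc e0 r0.
have : ((c - e)%:E < ereal_sup [set (u y)%:E | y in ball x r `&` A])%E.
  apply: (@lt_le_trans _ _ c%:E); first by rewrite lte_fin ltrBlDr ltrDl.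
  by rewrite -uc; apply: ereal_inf_lbound; exists r.
by move=> /ereal_sup_gt[_ [y [xy Ay] <-]]; rewrite lte_fin => cy; exists y.
Qed.

Lemma lsc_env_approx x (c e r : R) : lsc_env A u x = c%:E -> 0 < e -> 0 < r ->
  exists y, [/\ ball x r y, A y & u y < c + e].
Proof.
move=> uc e0 r0.
have : (ereal_inf [set (u y)%:E | y in ball x r `&` A] < (c + e)%:E)%E.
  apply: (@le_lt_trans _ _ c%:E); last by rewrite lte_fin ltrDl.
  by rewrite -uc; apply: ereal_sup_ubound; exists r.
by move=> /ereal_inf_lt[_ [y [xy Ay] <-]]; rewrite lte_fin => cy; exists y.
Qed.

Lemma usc_env_usc x (c e : R) : usc_env A u x = c%:E -> 0 < e ->
  \forall y \near x, (usc_env A u y < (c + e)%:E)%E.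
Proof.
move=> uc e0.
have : (usc_env A u x < (c + e)%:E)%E by rewrite uc lte_fin ltrDl.
move=> /ereal_inf_lt[_ [r /= r0 <-] rc].
have r20 : 0 < r / 2 by rewrite divr_gt0.
apply/nbhs_ballP; exists (r / 2) => //= y xy.
apply: le_lt_trans rc; apply: (@le_trans _ _ (ereal_sup [set (u z)%:E | z in ball y (r / 2) `&` A])).
  by apply: ereal_inf_lbound; exists (r / 2).
apply: ge_ereal_sup => _ [z [yz Az] <-]; apply: ereal_sup_ubound; exists z => //; split=> //.
by rewrite [r]splitr; exact: ball_triangle xy yz.
Qed.

End Envelopes.

Section Quadratic.
Variables (R : realType) (n : nat).
Implicit Types (x y z b : 'rV[R]_n) (B : 'M[R]_n).

(** There is no factor one half: for symmetric [B] the Hessian is [2 *: B]. *)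
Definition quadratic (c : R) b B x y := c + dot (y - x) b + qform B (y - x).

(** An exact identity, so the sign of [qform B (y - z)] decides between convexity and concavity on
    the line through [y] and [z]. *)
Lemma quadratic_conv c b B x y z (t : R) :
  quadratic c b B x (t *: y + (1 - t) *: z) =
  t * quadratic c b B x y + (1 - t) * quadratic c b B x z
    - t * (1 - t) * qform B (y - z).
Proof.
rewrite /quadratic.
have -> : t *: y + (1 - t) *: z - x = t *: (y - x) + (1 - t) *: (z - x).
  by apply/rowP => i; rewrite !mxE; ring.
rewrite qform_conv (_ : y - x - (z - x) = y - z); last by rewrite opprB addrA subrK.
by rewrite (dotDl (t *: _)) !dotZl; ring.
Qed.

Lemma quadratic_continuous c b B x : continuous (quadratic c b B x).
Proof.
have sc y : {for y, continuous (fun z : 'rV[R]_n => z - x)}.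
  by apply: continuousB; [exact: cvg_id|exact: cst_continuous].
rewrite (_ : quadratic c b B x = cst c \+ (dot b \o (fun z => z - x))
    \+ (qform B \o (fun z => z - x))); last first.
  by apply/funext => z; rewrite /quadratic/= dotC.
move=> y; apply: continuousD.
  apply: continuousD; first exact: cst_continuous.
  by apply: continuous_comp; [exact: sc|exact: dot_continuous].
by apply: continuous_comp; [exact: sc|exact: qform_continuous].
Qed.

End Quadratic.

(** * The two viscosity inequalities for the supremum *)

Section PerronSolution.
Variables (R : realType) (N j : nat) (Omega : set 'rV[R]_N) (g : 'rV[R]_N -> R).
Hypotheses (hj : (1 <= j <= N)%N) (oOmega : open Omega) (hbnd : bounded_set Omega).
Hypothesis (hg : {within boundary_in setT Omega, continuous g}).
Implicit Types (x y h p : 'rV[R]_N) (V : {vspace 'rV[R]_N}) (D U : set 'rV[R]_N).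

Local Notation u := (sup_H j Omega g).
Local Notation up := (usc_env (closure Omega) u).
Local Notation lo := (lsc_env (closure Omega) u).

Let clO x : Omega x -> closure Omega x. Proof. exact: subset_closure. Qed.

Lemma sup_H_env_fin x : Omega x -> lo x \is a fin_num /\ up x \is a fin_num.
Proof.
move=> Ox; have [M uM] := sup_H_bounded hj oOmega hbnd hg.
have uM1 y : closure Omega y -> u y <= M by move=> /uM; rewrite ler_norml => /andP[].
have uM2 y : closure Omega y -> - M <= u y by move=> /uM; rewrite ler_norml => /andP[].
split; apply: fin_real; apply/andP; split.
- exact: lt_le_trans (ltNyr _) (lsc_env_ge x uM2).
- exact: le_lt_trans (lsc_env_le u (clO Ox)) (ltry _).
- exact: lt_le_trans (ltNyr _) (le_usc_env u (clO Ox)).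
- exact: le_lt_trans (usc_env_le x uM1) (ltry _).
Qed.

Lemma closure_translate_ball V p q (r e : R) y : 0 < e ->
  closure (translate V p `&` ball q r) y -> `|q - y| < r + e.
Proof.
move=> e0 cy; have [z [[_ qz] yz]] := cy _ (nbhsx_ballx y e e0).
by move: (ball_triangle qz (ball_sym yz)); rewrite -ball_normE.
Qed.

(* A point of touching from above at which [j] eigenvalues are negative is
   excluded by comparing [u] with a concave function on a small [j]-dimensional
   disc through a nearby point. *)
Lemma sup_H_subsolution psi x : C2_on Omega psi -> Omega x ->
  strict_max Omega (fun y => up y - (psi y)%:E)%E x -> up x = (psi x)%:E ->
  0 <= lambda j (hessian psi x).
Proof.
move=> psiC2 Ox smax upx; rewrite leNgt; apply/negP => lam0.
set H := hessian psi x in lam0; set lam := lambda j H in lam0.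
have symH : H^T = H := hessian_sym oOmega psiC2 Ox.
have [V [dV VH]] := lambda_min_max hj symH.
(* With this value [B = H / 2 + 2 e] is still nonpositive on [V]. One of the two [e] absorbs the
   Taylor remainder, the other leaves the gap [e * |y - x| ^+ 2] between u and [q]. *)
pose e := - lam / 4; have e0 : 0 < e by rewrite divr_gt0// oppr_gt0.
have [r r0 rP] := taylor2 oOmega psiC2 Ox e0.
pose b := grad psi x; pose B := 2^-1 *: H + (2 * e)%:M.
pose q := quadratic (psi x) b B x.
have u_psi y : Omega y -> u y <= psi y.
  move=> Oy; have [_ fy] := sup_H_env_fin Oy.
  have := le_usc_env u (clO Oy); rewrite -(fineK fy) lee_fin => /le_trans; apply.
  have [->|yx] := eqVneq y x; first by rewrite upx.
  have := smax y Oy (fun yx' => negP yx (introT eqP yx')).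
  by rewrite upx -(fineK fy) -!EFinB lte_fin subrr subr_lt0 => /ltW.
have u_q y : `|y - x| < r -> u y <= q y - e * `|y - x| ^+ 2.
  move=> yr; have [] := rP _ yr; rewrite addrC subrK => Oy.
  rewrite -/b -/H ler_norml => /andP[_ T].
  apply: le_trans (u_psi _ Oy) _.
  rewrite /q /quadratic /B qform_mxD qform_mxZ qform_scalar.
  have D := norm_sqr_le_dot (y - x).
  have : e * `|y - x| ^+ 2 <= e * dot (y - x) (y - x) by rewrite ler_pM2l.
  by move: T; set a := qform H _; lra.
pose rho := r / 4; have rho0 : 0 < rho by rewrite divr_gt0.
have rho20 : 0 < rho / 2 by rewrite divr_gt0.
(* The disc has radius [rho] and a center within [rho / 2] of [x], so its rim is at distance at
   least [rho / 2] from [x], where the gap is at least [d]. *)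
pose d := e * (rho / 2) ^+ 2.
have d0 : 0 < d by rewrite mulr_gt0// exprn_gt0// divr_gt0.
have d20 : 0 < d / 2 by rewrite divr_gt0.
have [s s0 qs] : exists2 s : R, 0 < s & forall y, `|x - y| < s -> q y < psi x + d / 2.
  have /cvgrPdist_lt/(_ _ d20)/nbhs_ballP[s s0 sP] : q @ x --> q x.
    exact: quadratic_continuous.
  exists s => // y xy; have := sP y; rewrite -ball_normE/= => /(_ xy).
  have -> : q x = psi x by rewrite /q /quadratic subrr dot0l qform0 !addr0.
  by rewrite distrC ltr_distl => /andP[].
pose s' := Num.min s (rho / 2).
have s'0 : 0 < s' by rewrite lt_min s0 divr_gt0.
(* Here [u y0 > psi x - d / 2] while [q y0 < psi x + d / 2], so [u y0 <= q y0 - d] is impossible. *)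
have [y0 [xy0 cy0 uy0]] := usc_env_approx upx d20 s'0.
rewrite -ball_normE/= lt_min in xy0; have /andP[y0s y0r] := xy0.
have near_y0 y (a : R) : `|y0 - y| < a -> `|y - x| < a + rho / 2.
  move=> ya; rewrite (_ : y - x = (y - y0) + (y0 - x)); last by rewrite addrA subrK.
  apply: le_lt_trans (ler_normD _ _) _; apply: ltrD; rewrite distrC//.
suff : u y0 <= q y0 - d by have := qs _ y0s; lra.
have /H_classP[_ uH] := sup_H_in_H hj oOmega hbnd hg.
apply: (uH V y0 (ball y0 rho) (fun y => q y - d) y0 dV).
- exact: ball_open.
- exact: domain_in_translate_ball.
- move=> y [_]; rewrite -ball_normE/= => /near_y0 yr.
  have [] := rP (y - x); first by rewrite /rho in yr; lra.
  by rewrite addrC subrK.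
- apply: (@concave_onS _ _ _ (translate V y0)); first exact: hull_closure_translate.
  apply/concave_onE => y z t Sy Sz t0 t1.
  rewrite /q quadratic_conv -/q.
  suff : t * (1 - t) * qform B (y - z) <= 0 by lra.
  apply: mulr_ge0_le0; first by rewrite mulr_ge0// subr_ge0.
  have := VH _ (translateB Sy Sz); rewrite -/lam => le.
  by rewrite /B qform_mxD qform_mxZ qform_scalar /e; lra.
- move=> y By; have [[_ cy] _] := By.
  have nby := boundary_translate_out (ball_open y0 rho) By.
  have yr : `|y - x| < r.
    have := closure_translate_ball rho20 cy.
    by move=> /near_y0; rewrite /rho; lra.
  have yrho : rho / 2 <= `|y - x|.
    move: nby; rewrite -ball_normE/= => /negP; rewrite -leNgt => le.
    have : `|y0 - y| <= `|x - y0| + `|y - x|.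
      rewrite distrC [leRHS]addrC (_ : y - y0 = (y - x) + (x - y0)).
        exact: ler_normD.
      by rewrite addrA subrK.
    lra.
  apply: le_trans (u_q _ yr) _; rewrite lerD2l lerN2 /d ler_pM2l//.
  by rewrite ler_sqr ?nnegrE// divr_ge0// ltW.
- by split; [exact: translate_refl|exact: ballxx].
Qed.

(* Otherwise a paraboloid slightly above [u] near [x] could be glued to [u]
   inside the class: on each [j]-dimensional plane it is convex along some
   direction, hence lies below any concave majorant of its values at the two
   exit points of a line. *)
Lemma sup_H_supersolution phi x : C2_on Omega phi -> Omega x ->
  strict_min Omega (fun y => lo y - (phi y)%:E)%E x -> lo x = (phi x)%:E ->
  lambda j (hessian phi x) <= 0.
Proof.
move=> phiC2 Ox smin lox; rewrite leNgt; apply/negP => lam0.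
set H := hessian phi x in lam0; set lam := lambda j H in lam0.
have symH : H^T = H := hessian_sym oOmega phiC2 Ox.
(* The mirror choice: [B = H / 2 - 2 e] is still nonnegative at a vector of each [j]-dimensional
   space. *)
pose e := lam / 4; have e0 : 0 < e by rewrite divr_gt0.
have [r r0 rP] := taylor2 oOmega phiC2 Ox e0.
pose b := grad phi x; pose B := 2^-1 *: H + (- (2 * e))%:M.
pose q := quadratic (phi x) b B x.
have inO y : `|y - x| < r -> Omega y.
  by move=> /rP[]; rewrite addrC subrK.
have u_phi y : Omega y -> phi y <= u y.
  move=> Oy; have [fy _] := sup_H_env_fin Oy.
  have := lsc_env_le u (clO Oy); rewrite -(fineK fy) lee_fin; apply: le_trans.
  have [->|yx] := eqVneq y x; first by rewrite lox.
  have := smin y Oy (fun yx' => negP yx (introT eqP yx')).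
  by rewrite lox -(fineK fy) -!EFinB lte_fin subrr subr_gt0 => /ltW.
have u_q y : `|y - x| < r -> q y + e * `|y - x| ^+ 2 <= u y.
  move=> yr; have [] := rP _ yr; rewrite addrC subrK => Oy.
  rewrite -/b -/H ler_norml => /andP[T _].
  apply: le_trans (u_phi _ Oy).
  rewrite /q /quadratic /B qform_mxD qform_mxZ qform_scalar.
  have D := norm_sqr_le_dot (y - x).
  have : e * `|y - x| ^+ 2 <= e * dot (y - x) (y - x) by rewrite ler_pM2l.
  by move: T; set a := qform H _; lra.
pose rho := r / 2; have rho0 : 0 < rho by rewrite divr_gt0.
have rho20 : 0 < rho / 2 by rewrite divr_gt0.
pose d := e * rho ^+ 2.
have d0 : 0 < d by rewrite mulr_gt0// exprn_gt0.
have d20 : 0 < d / 2 by rewrite divr_gt0.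
have u_qd y : `|y - x| < r -> rho <= `|y - x| -> q y + d <= u y.
  move=> yr ry; apply: le_trans (u_q _ yr); rewrite lerD2l /d ler_pM2l//.
  by rewrite ler_sqr ?nnegrE// ltW.
have [s s0 qs] : exists2 s : R, 0 < s & forall y, `|x - y| < s -> phi x - d / 2 < q y.
  have /cvgrPdist_lt/(_ _ d20)/nbhs_ballP[s s0 sP] : q @ x --> q x.
    exact: quadratic_continuous.
  exists s => // y xy; have := sP y; rewrite -ball_normE/= => /(_ xy).
  have -> : q x = phi x by rewrite /q /quadratic subrr dot0l qform0 !addr0.
  by rewrite distrC ltr_distl => /andP[].
pose s' := Num.min s rho.
have s'0 : 0 < s' by rewrite lt_min s0.
have [y0 [xy0 cy0 uy0]] := lsc_env_approx lox d20 s'0.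
rewrite -ball_normE/= lt_min in xy0; have /andP[y0s y0r] := xy0.
(* By [u_qd] the raised paraboloid is below u from distance [rho] on, so the gluing is harmless; at
   [y0] it is strictly above u, so [v] in the class would contradict the definition of u. *)
pose v y := if `|y - x| < rho then Num.max (u y) (q y + d) else u y.
have uv y : u y <= v y by rewrite /v; case: ifP => // _; rewrite le_max lexx.
suff vH : H_class j Omega g v.
  have := le_sup_H hj oOmega hbnd hg vH cy0.
  rewrite /v distrC y0r ge_max => /andP[_]; have := qs _ y0s; lra.
have /H_classP[ug uH] := sup_H_in_H hj oOmega hbnd hg.
apply/H_classP; split=> [y By|].
  have [_ nO] := (boundaryP oOmega y).1 By.
  rewrite /v; case: ifP => [yr|_]; last exact: ug.
  by exfalso; apply: nO; apply: inO; apply: lt_trans yr _; rewrite /rho; lra.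
move=> V p U f z dV oU D dD DO cf vf Dz.
have uf y : D y -> u y <= f y.
  by apply: (uH V p U f y) => // a Ba; apply: le_trans (uv a) (vf _ Ba).
rewrite {1}/v; case: ifP => [zr|_]; last exact: uf.
rewrite ge_max uf//=; have [Sz Uz] := Dz.
have [h [hV h0 hH]] := lambda_max_min hj symH dV.
have hB : 0 <= qform B h.
  by rewrite /B qform_mxD qform_mxZ qform_scalar /e; move: hH; rewrite -/lam; lra.
apply: (@line_comparison R N V p (U `&` ball x rho) z h _ f (fun y => q y + d)
  _ _ Sz _ hV h0 cf).
- by apply: openI => //; exact: ball_open.
- apply: (@sub_bounded_set _ _ _ Omega) => // y [_].
  by rewrite -ball_normE/= distrC => yr; apply: inO; rewrite /rho in yr; lra.
- by split=> //; rewrite -ball_normE/= distrC.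
- move=> y Sy nOy cy.
  have cDy : closure D y by apply: closure_subset cy => a [Sa [Ua _]].
  have yr : `|y - x| < r.
    have cy' : closure (translate V p `&` ball x rho) y.
      by apply: closure_subset cy => a [Sa [_ ra]].
    have := closure_translate_ball rho20 cy'.
    by rewrite distrC /rho; lra.
  split; first exact: sub_convex_hull.
  (* The line leaves either the ball while still in D, where [q + d <= u <= f], or D itself, where
     [q + d <= v <= f] by the boundary assumption. *)
  have [Uy|nU] := pselect (U y).
    apply: le_trans (uf y (conj Sy Uy)); apply: u_qd => //.
    rewrite leNgt; apply/negP => lt; apply: nOy; split=> //.
    by rewrite -ball_normE/= distrC.
  apply: le_trans (vf y (boundary_translate Sy nU cDy)).
  rewrite /v; case: ifP => [_|/negbT]; first by rewrite le_max lexx orbT.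
  by rewrite -leNgt; exact: u_qd.
- move=> a c k t ac t0 t1; rewrite /q quadratic_conv -/q ac qformZ.
  suff : 0 <= t * (1 - t) * (k ^+ 2 * qform B h) by lra.
  apply: mulr_ge0; first by rewrite mulr_ge0// subr_ge0.
  by apply: mulr_ge0 => //; exact: sqr_ge0.
Qed.

End PerronSolution.

(** * Maximality *)

Section UpperSemicontinuous.
Variables (R : realType) (n : nat).
Implicit Types (K : set 'rV[R]_n) (F : 'rV[R]_n -> R).

Definition usc_on K F := forall x, K x -> forall e : R, 0 < e ->
  \forall y \near x, K y -> F y < F x + e.

Lemma usc_onS K L F : K `<=` L -> usc_on L F -> usc_on K F.
Proof.
move=> KL Lu x Kx e e0; apply: filterS (Lu x (KL _ Kx) e e0) => y yF Ky.
exact/yF/KL.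
Qed.

Lemma usc_onD K F (G : 'rV[R]_n -> R) : usc_on K F -> continuous G ->
  usc_on K (fun x => F x + G x).
Proof.
move=> Fu Gc x Kx e e0; have e20 : 0 < e / 2 by rewrite divr_gt0.
have /cvgrPdist_lt/(_ _ e20) G1 : G @ x --> G x by exact: Gc.
apply: filterS2 (Fu x Kx _ e20) G1 => y Fy; rewrite distrC ltr_distl => /andP[_ Gy] Ky.
by have := Fy Ky; lra.
Qed.

Lemma usc_on_bounded K F : compact K -> usc_on K F ->
  exists M : R, forall x, K x -> F x <= M.
Proof.
move=> /compact_near_coveringP cK Fu.
have [M [_ MP]] : \forall M \near +oo_R, K `<=` [set x | K x -> F x < M].
  apply: cK => x Kx.
  exists ([set y | K y -> F y < F x + 1], [set M | F x + 1 < M]) => /=.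
    split; first exact: Fu.
    by exists (F x + 1); split=> //; exact: num_real.
  by move=> [y M] [/= yF FM] Ky; exact: lt_trans (yF Ky) FM.
by exists (M + 1) => x Kx; apply/ltW/MP => //; rewrite ltrDl.
Qed.

(** If the supremum [s] were not attained, near each point [F < s - 1 / (k + 1)] would hold for all
    large [k]; compactness makes one [k] serve all of [K], contradicting the choice of [s]. *)
Lemma usc_on_max K F : compact K -> K !=set0 -> usc_on K F ->
  exists2 c, K c & forall x, K x -> F x <= F c.
Proof.
move=> cK K0 Fu; have [M FM] := usc_on_bounded cK Fu.
pose s := sup (F @` K).
have hs : has_sup (F @` K).
  split; first by have [x Kx] := K0; exists (F x), x.
  by exists M => _ [x Kx <-]; exact: FM.
have Fs x : K x -> F x <= s by move=> Kx; apply: sup_upper_bound => //; exists x.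
apply: contrapT => nmax.
have lts x : K x -> F x < s.
  move=> Kx; rewrite ltNge; apply/negP => sF; apply: nmax; exists x => // y Ky.
  exact: le_trans (Fs y Ky) sF.
have /compact_near_coveringP cK' := cK.
have : \forall k \near \oo, K `<=` [set x | K x -> F x < s - k.+1%:R^-1].
  apply: cK' => x Kx; pose d := (s - F x) / 2.
  have d0 : 0 < d by rewrite divr_gt0// subr_gt0 lts.
  exists ([set y | K y -> F y < F x + d], [set k | k.+1%:R^-1 < d]) => /=.
    split; first exact: Fu.
    exact: near_infty_natSinv_lt (PosNum d0).
  move=> [y k] [/= yF kd] /= Ky; have := yF Ky.
  by move: kd; rewrite /d; set t := _^-1; lra.
move=> [k _ /(_ k (leqnn k)) kP].
have k0 : 0 < k.+1%:R^-1 :> R by rewrite invr_gt0.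
have [_ [x Kx <-] sx] := sup_adherent k0 hs.
have h : F x < s - k.+1%:R^-1 := kP x Kx Kx.
by have := lt_trans sx h; rewrite ltxx.
Qed.

End UpperSemicontinuous.

(** * The upper envelope of a solution belongs to the class *)

Section Maximality.
Variables (R : realType) (N j : nat) (Omega : set 'rV[R]_N) (g w : 'rV[R]_N -> R).
Hypotheses (hj : (1 <= j <= N)%N) (oOmega : open Omega) (hbnd : bounded_set Omega).
Local Notation wup := (usc_env (closure Omega) w).
Hypothesis wsol : viscosity_solution j Omega w.
Hypothesis wg : forall x, boundary_in setT Omega x -> (wup x <= (g x)%:E)%E.
Implicit Types (x y h p : 'rV[R]_N) (V : {vspace 'rV[R]_N}) (D U : set 'rV[R]_N).

(** Finiteness comes from the definition of a solution inside Omega, and from the bounds [w] and [g]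
    on its boundary. It allows the envelope to be handled as the real function [v]. *)
Lemma usc_env_fineK x : closure Omega x -> wup x = (fine (wup x))%:E.
Proof.
move=> cx; rewrite fineK//; have [Ox|Bx] := closure_cases oOmega cx.
  by have [wfin _ _] := wsol; have [] := wfin x Ox.
apply: fin_real; apply/andP; split; first exact: lt_le_trans (ltNyr _) (le_usc_env w cx).
exact: le_lt_trans (wg Bx) (ltry _).
Qed.

Variable v : 'rV[R]_N -> R.
Hypothesis vE : forall x, closure Omega x -> wup x = (v x)%:E.

Let clO x : Omega x -> closure Omega x. Proof. exact: subset_closure. Qed.

Lemma usc_env_usc_on : usc_on (closure Omega) v.
Proof.
move=> x cx e e0; apply: filterS (usc_env_usc (vE cx) e0) => y + cy.
by rewrite vE// lte_fin.
Qed.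

Let ccO : compact (closure Omega).
Proof. by apply: bounded_closed_compact; [exact: closure_bounded|exact: closed_closure]. Qed.

(* Adding a large multiple of a quartic makes the local maximum at [c] global
   and strict without changing the Hessian there. *)
Lemma quadratic_touching (d : R) b (Q : 'M[R]_N) x0 c (r : R) :
  Q^T = Q -> Omega c -> 0 < r ->
  (forall y, Omega y -> `|y - c| < r ->
     v y - quadratic d b Q x0 y <= v c - quadratic d b Q x0 c) ->
  0 <= lambda j (2 *: Q).
Proof.
move=> symQ Oc r0 cmax; have [_ _ wsub] := wsol.
have Gc : continuous (fun y => - quadratic d b Q x0 y).
  by move=> y; apply: continuousN; exact: quadratic_continuous.
have [M GM] := usc_on_bounded ccO (usc_onD usc_env_usc_on Gc).
set G := fun y => v y - quadratic d b Q x0 y in cmax.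
have MG : 0 <= M - G c by rewrite subr_ge0; apply: GM; exact: clO.
(* Beyond distance [r] the quartic term is then at least [M - G c + 1], more than [G] can gain over
   [G c]; within [r] it only makes the maximum strict. *)
pose C := (M - G c + 1) / r ^+ 4.
have r40 : 0 < r ^+ 4 by rewrite exprn_gt0.
have C0 : 0 < C by rewrite divr_gt0//; lra.
have [psi [psiC2 psiH psiE]] : exists psi, [/\ C2_on Omega psi, hessian psi c = 2 *: Q &
    forall y, psi y = quadratic d b Q x0 y - quadratic d b Q x0 c + v c
      + C * \sum_i (y - c) 0 i ^+ 4].
  (* The paraboloid re-expanded about [c]: the linear coefficient is its gradient there. *)
  exists (quartic_test (v c) C (b + 2 *: ((c - x0) *m Q)) c Q); split=> [||y].
  - exact: quartic_test_C2.
  - exact: hessian_quartic_test.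
  rewrite /quartic_test /quadratic.
  have -> : y - x0 = (y - c) + (c - x0) by rewrite addrA subrK.
  rewrite (qform_dotD Q (y - c)) (dotDl (y - c)) (dotC ((y - c) *m Q)) dot_mxr symQ.
  by rewrite (dotDl b) dotZl (dotC b); ring.
rewrite -psiH.
have E y : Omega y -> (wup y - (psi y)%:E)%E = (v y - psi y)%:E.
  by move=> Oy; rewrite vE//; exact: clO.
have psic : psi c = v c.
  by rewrite psiE !subrr add0r big1 ?mulr0 ?addr0// => i _; rewrite mxE expr0n.
have lteE (p q : \bar R) (s t : R) : p = s%:E -> q = t%:E -> s < t -> (p < q)%E.
  by move=> -> ->; rewrite lte_fin.
have wc : wup c = (psi c)%:E by rewrite psic vE//; exact: clO.
apply: (wsub psi c psiC2 Oc _ wc) => y Oy yc.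
apply: (lteE _ _ _ _ (E y Oy) (E c Oc)); rewrite psic (subrr (v c)) psiE.
  have s4 i : 0 <= (y - c) 0 i ^+ 4 by rewrite (exprM _ 2 2) sqr_ge0.
  have yc0 : 0 < `|y - c| by rewrite normr_gt0 subr_eq0; apply/eqP.
  have sum4 : `|y - c| ^+ 4 <= \sum_i (y - c) 0 i ^+ 4.
    have [i ->] : exists i, `|y - c| = `|(y - c) 0 i|.
      have /mx_norm_neq0[[k i]] /= : mx_norm (y - c) != 0 by rewrite gt_eqF.
      by rewrite ord1 => E1; exists i.
    rewrite (bigD1 i)//= -normrX ger0_norm// lerDl.
    by apply: sumr_ge0 => k _.
  have p4 : 0 < `|y - c| ^+ 4 by rewrite exprn_gt0.
  set S := \sum_i _ in sum4 *.
  have [yr|yr] := ltP `|y - c| r.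
    have := cmax y Oy yr; rewrite /G.
    have : 0 < C * S by rewrite mulr_gt0//; exact: lt_le_trans sum4.
    lra.
  have rS : r ^+ 4 <= S.
    by apply: le_trans sum4; rewrite lerXn2r// ?nnegrE// ltW.
  have : M - G c + 1 <= C * S.
    by rewrite /C mulrAC ler_pdivlMr// ler_pM2l//; lra.
  have := GM y (clO Oy); rewrite /G /=.
  lra.
Qed.

(** Let [m] be the excess of [v] over [d] at [x0]. After subtraction of a suitable paraboloid the
    excess at [x0] is still [m], while the values are below [m] on the rim of a compact cylinder
    over D. The maximum then lies in the open part of the cylinder, where [quadratic_touching]
    forces a nonnegative direction in [V], although the paraboloid is strictly concave along [V]. *)
Lemma usc_env_affine V p U x0 (d : R) b : \dim V = j -> open U ->
  let D := translate V p `&` U in D `<=` Omega -> D x0 ->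
  (forall y, boundary_in (translate V p) D y -> v y <= d + dot b (y - x0)) ->
  v x0 <= d.
Proof.
move=> dV oU D DO [Sx0 Ux0] vd; rewrite leNgt; apply/negP => dv.
have Ox0 : Omega x0 by exact: DO.
have [M [MV Mid]] := vspace_projection V.
pose pi y := x0 + (y - x0) *m M.
have piS y : translate V p (pi y) by apply: translateD; rewrite ?MV.
have pi_id y : translate V p y -> pi y = y.
  by move=> Sy; rewrite /pi Mid ?(translateB Sy Sx0)// addrC subrK.
have pic : continuous pi.
  exact: affine_projection_continuous.
(* [qform T (y - x0)] is the squared Euclidean length of [y - pi y]; it vanishes exactly on the
   plane. *)
pose L := 1%:M - M; pose T := L *m L^T.
have symT : T^T = T by rewrite /T trmx_mul trmxK.
have qT h : qform T h = dot (h *m L) (h *m L).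
  by rewrite /qform /T mulmxA dot_mxr.
have T0 y : qform T (y - x0) = 0 -> pi y = y.
  rewrite qT => /eqP; rewrite dot_eq0 /L mulmxBr mulmx1 subr_eq0 => /eqP yM.
  by rewrite /pi -yM addrC subrK.
have Tge y : 0 <= qform T y by rewrite qT dot_ge0.
have [m mE] : exists m, m = v x0 - d by exists (v x0 - d).
have m0 : 0 < m by rewrite mE subr_gt0.
have [B0 B00 OB] : exists2 B : R, 0 <= B & forall y, closure Omega y -> dot (y - x0) (y - x0) <= B.
  have cd : usc_on (closure Omega) (fun y => 0 + quadratic 0 0 1%:M x0 y).
    apply: usc_onD; last exact: quadratic_continuous.
    by move=> x _ e e0; near=> y => _; rewrite add0r.
  have [B BP] := usc_on_bounded ccO cd.
  have qE y : 0 + quadratic 0 0 1%:M x0 y = dot (y - x0) (y - x0).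
    by rewrite /quadratic qform_scalar dotC dot0l; ring.
  exists B => [|y /BP]; last by rewrite qE.
  by have := BP x0 (clO Ox0); rewrite qE subrr dot0l.
have [e e0 eB] : exists2 e : R, 0 < e &
    forall y, closure Omega y -> e * dot (y - x0) (y - x0) < m.
  have B10 : 0 < B0 + 1 by lra.
  exists (m / (B0 + 1) / 2) => [|y cy]; first by rewrite !divr_gt0.
  apply: (@le_lt_trans _ _ (m / 2)); last by lra.
  rewrite mulrAC ler_pM2r ?invr_gt0// mulrAC ler_pdivrMr// ler_pM2l//.
  by have := OB y cy; move: (dot _ _) => a; lra.
pose Q (k : R) := k *: T + (- e)%:M.
have symQ k : (Q k)^T = Q k by rewrite /Q linearD linearZ/= symT tr_scalar_mx.
have [G GQ] : exists G : R -> 'rV[R]_N -> R,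
    forall k y, G k y = v y - quadratic d b (Q k) x0 y.
  by exists (fun k y => v y - quadratic d b (Q k) x0 y).
have GE k y : G k y = G 0 y - k * qform T (y - x0).
  by rewrite !GQ /quadratic /Q !qform_mxD !qform_mxZ; ring.
have Gu k : usc_on (closure Omega) (G k).
  rewrite (_ : G k = fun y => v y - quadratic d b (Q k) x0 y); last exact/funext/GQ.
  apply: usc_onD; first exact: usc_env_usc_on.
  by move=> y; apply: continuousN; exact: quadratic_continuous.
have Gx0 k : G k x0 = m.
  by rewrite GQ mE /quadratic subrr dot0l qform0 !addr0.
pose Good := Omega `&` pi @^-1` U.
have oGood : open Good by apply: openI => //; apply: open_comp => // y _; exact: pic.
(* The cylinder over the closure of D, with open part [Good]; a maximum over [K] reached in [Good]
   is a local maximum in the full space. *)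
pose K := closure Omega `&` pi @^-1` (closure D).
have cK : compact K.
  apply: bounded_closed_compact.
    by apply: sub_bounded_set (closure_bounded hbnd) => y [].
  apply: closedI; first exact: closed_closure.
  by apply: preimage_closed; [move=> y _; exact: pic|exact: closed_closure].
have GoodK : Good `<=` K.
  by move=> y [Oy Uy]; split; [exact: clO|apply: subset_closure; split].
have cK' : compact (K `\` Good).
  apply: bounded_closed_compact.
    by apply: sub_bounded_set (closure_bounded hbnd) => y [[]].
  rewrite setDE; apply: closedI; first exact: compact_closed (@norm_hausdorff _ _) cK.
  exact: open_closedC.
(* On [K] outside [Good], [G 0] is less than [m] where the penalization vanishes. *)
have edge y : (K `\` Good) y -> qform T (y - x0) = 0 -> G 0 y < m.
  move=> [[cy Dy] nG] /T0 piy; rewrite /= piy in Dy.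
  have Sy : translate V p y by rewrite -piy.
  have nU : ~ U y.
    move=> Uy; apply: nG; split; last by rewrite /= piy.
    by apply: DO.
  have := vd y (boundary_translate Sy nU Dy); have := eB y cy.
  rewrite GQ /quadratic /Q scale0r add0r qform_scalar (dotC b).
  by move: (v y) (dot _ b) (dot _ _) => a1 a2 a3; lra.
(* Near a point of the plane [edge] and semicontinuity suffice for every [k >= 0]; near any other
   point [qform T] stays above a positive [t], so [k > (|G 0 y| + 1) / t] makes [G k] negative.
   Compactness gives a common [k]. *)
have [k [k0 kP]] : exists k : R, 0 <= k /\ forall y, (K `\` Good) y -> G k y < m.
  have /compact_near_coveringP cK'' := cK'.
  have [k [_ kP]] : \forall k \near +oo_R,
      K `\` Good `<=` [set y | 0 <= k -> (K `\` Good) y -> G k y < m].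
    apply: cK'' => y K'y; have [[cy Dy] nG] := K'y.
    have [Ty|Ty] := eqVneq (qform T (y - x0)) 0.
      have Gy : 0 < m - G 0 y by rewrite subr_gt0 edge.
      exists ([set z | closure Omega z -> G 0 z < G 0 y + (m - G 0 y)], setT) => /=.
        by split; [exact: Gu|exact: filterT].
      move=> [z k] [/= zG _] /= k0 [[cz _] _]; have := zG cz.
      have := mulr_ge0 k0 (Tge (z - x0)); rewrite (GE k).
      by move: (G 0 z) (G 0 y) (k * _) => a1 a2 a3; lra.
    have Tp : 0 < qform T (y - x0) by rewrite lt_def Ty Tge.
    pose t := qform T (y - x0) / 2; have t0 : 0 < t by rewrite divr_gt0.
    have nT : \forall z \near y, t < qform T (z - x0).
      have /cvgrPdist_lt/(_ _ t0) : quadratic 0 0 T x0 @ y --> quadratic 0 0 T x0 y.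
        exact: quadratic_continuous.
      apply: filterS => z; rewrite /quadratic !(dotC _ 0) !dot0l !add0r ltr_distlC.
      by rewrite /t => /andP[]; lra.
    exists ([set z | (closure Omega z -> G 0 z < G 0 y + 1) /\ t < qform T (z - x0)],
            [set k | (`|G 0 y| + 1) / t < k]) => /=.
      split; first by apply: filterI => //; exact: Gu.
      by exists ((`|G 0 y| + 1) / t); split=> //; exact: num_real.
    move=> [z k] [/= [zG zt] kG] /= k0 [[cz _] _]; have := zG cz; rewrite (GE k).
    have : `|G 0 y| + 1 < k * t by rewrite -ltr_pdivrMr.
    have : k * t <= k * qform T (z - x0) by rewrite ler_wpM2l// ltW.
    by have := ler_norm (G 0 y); lra.
  exists (`|k| + 1); split=> [|y K'y]; first by rewrite addr_ge0.
  apply: (kP (`|k| + 1)) => //.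
  by apply: le_lt_trans (ler_norm k) _; rewrite ltrDl.
have Kx0 : K x0.
  by split; [exact: clO|rewrite /= pi_id//; apply: subset_closure].
have [|c Kc cmax] := usc_on_max cK (ex_intro _ x0 Kx0) (F := G k).
  by apply: usc_onS (Gu k) => y [].
have Gc : Good c.
  apply: contrapT => nG; have := kP c (conj Kc nG).
  by have := cmax x0 Kx0; rewrite Gx0; lra.
have /nbhs_ballP[r r0 rG] : nbhs c Good by exact: open_nbhs_nbhs.
have lam : 0 <= lambda j (2 *: Q k).
  apply: (@quadratic_touching d b (Q k) x0 c r) => //; first by case: Gc.
  move=> y Oy yr; rewrite -!GQ; apply: cmax; apply: GoodK; apply: rG.
  by rewrite -ball_normE/= distrC.
have sym2 : (2 *: Q k)^T = 2 *: Q k by rewrite linearZ/= symQ.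
have [h [hV h0 hQ]] := lambda_max_min hj sym2 dV.
have dh0 : 0 < dot h h by rewrite lt_def dot_eq0 h0 dot_ge0.
have hL : h *m L = 0 by rewrite /L mulmxBr mulmx1 Mid// subrr.
have : 0 <= lambda j (2 *: Q k) * dot h h by rewrite mulr_ge0// ltW.
move=> /le_trans /(_ hQ); rewrite qform_mxZ /Q qform_mxD qform_mxZ qform_scalar.
rewrite qT hL dot0l; have : 0 < e * dot h h by rewrite mulr_gt0.
by move: (dot h h) => a; lra.
Unshelve. all: by end_near. Qed.

(** A concave majorant [f] is replaced by a supporting affine function at [x], which reduces the
    comparison to the affine case. *)
Lemma usc_env_in_H : H_class j Omega g v.
Proof.
apply/H_classP; split=> [x Bx|].
  by have [cx _] := (boundaryP oOmega x).1 Bx; rewrite -lee_fin -vE// wg.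
move=> V p U f x dV oU D dD DO cf vf Dx; have [Sx Ux] := Dx.
have [M [MV Mid]] := vspace_projection V.
pose pi y := x + (y - x) *m M.
have pi_id y : translate V p y -> pi y = y.
  by move=> Sy; rewrite /pi Mid ?(translateB Sy Sx)// addrC subrK.
have pi_conv y z (t : R) : pi (t *: y + (1 - t) *: z) = t *: pi y + (1 - t) *: pi z.
  have -> : t *: y + (1 - t) *: z = x + (t *: (y - x) + (1 - t) *: (z - x)).
    by apply/rowP => i; rewrite !mxE; ring.
  have piD a : pi (x + a) = x + a *m M by rewrite /pi (addrC x a) addrK.
  rewrite piD /pi mulmxDl -!scalemxAl.
  by apply/rowP => i; rewrite !mxE; ring.
(* The hull lies in the plane and may have no interior in the full space; pulling [f] back along the
   projection gives a concave function around a full ball at [x], as [concave_support] demands. *)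
pose K := pi @^-1` convex_hull (closure D).
have /convex_setE cH := @convex_hullP R N (closure D).
have cK : @convex_set R 'rV[R]_N K.
  by apply/convex_setE => y z t Ky Kz t0 t1; rewrite /K/= pi_conv; exact: cH.
have cfK : concave_on K (f \o pi).
  apply/concave_onE => y z t Ky Kz t0 t1; rewrite /= pi_conv.
  by move/concave_onE: cf; apply.
have [r r0 rK] : exists2 r : R, 0 < r & ball x r `<=` K.
  have : \forall y \near x, U (pi y).
    have pic : {for x, continuous pi} by exact: affine_projection_continuous.
    by apply: pic; apply: open_nbhs_nbhs; split=> //; rewrite pi_id.
  move=> /nbhs_ballP[r r0 rU]; exists r => // y /rU Uy.
  apply: sub_convex_hull; apply: subset_closure; split=> //.
  by apply: translateD; rewrite ?MV.
have [b bP] := concave_support r0 rK cK cfK.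
have pix : pi x = x by exact: pi_id.
apply: (@usc_env_affine V p U x (f x) b dV oU DO Dx) => y By.
apply: le_trans (vf y By) _; have [[Sy cy] _] := By.
have piy := pi_id y Sy.
have := bP y; rewrite /K/= piy pix dotC; apply; exact: sub_convex_hull.
Qed.

Lemma viscosity_le_usc_env x : closure Omega x -> w x <= v x.
Proof. by move=> cx; rewrite -lee_fin -vE// le_usc_env. Qed.

End Maximality.

Theorem theorem2 (R : realType) (N j : nat) (Omega : set 'rV[R]_N)
    (g : 'rV[R]_N -> R) (hj : (1 <= j <= N)%N)
    (hOmega : domain Omega) (hbnd : bounded_set Omega)
    (hg : {within boundary_in setT Omega, continuous g}) :
  let u := sup_H j Omega g in
  [/\ (* the supremum defining u is over a nonempty bounded above set *)
      forall x, closure Omega x -> has_sup [set v x | v in H_class j Omega g],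
      viscosity_solution j Omega u,
      forall x, boundary_in setT Omega x -> u x <= g x
    & forall w : 'rV[R]_N -> R,
        viscosity_solution j Omega w ->
        (* w <= g on the boundary, for a possibly discontinuous w *)
        (forall x, boundary_in setT Omega x ->
           (usc_env (closure Omega) w x <= (g x)%:E)%E) ->
        forall x, closure Omega x -> w x <= u x].
Proof.
have [oO _ _] := hOmega; move=> u; split.
- exact: H_values_has_sup.
- split; first exact: sup_H_env_fin.
    by move=> phi x; exact: sup_H_supersolution.
  by move=> psi x; exact: sup_H_subsolution.
- exact: sup_H_boundary.
- move=> w wsol wg x cx; have wE := usc_env_fineK oO wsol wg.
  apply: le_trans (viscosity_le_usc_env wE cx) _.
  have vH := usc_env_in_H hj oO hbnd wsol wg wE.
  exact: (le_sup_H hj oO hbnd hg vH cx).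
Qed.
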